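(* Let $\Bbbk$ be a field, let $\alpha\in\Bbbk^\times$, and let $B=B_K(\alpha)$ be the connected graded $\Bbbk$-algebra generated by the degree-one elements $x_1,x_2,y_1,y_2$ subject to the relations $$x_2x_1=-x_1x_2,\quad y_2y_1=-y_1y_2,\quad y_1x_1=x_1y_1,\quad y_1x_2=x_2y_2,\quad y_2x_1=x_1y_2,\quad y_2x_2=\alpha x_2y_1.$$ Let $M_x=B/(x_1,x_2)B$, where $(x_1,x_2)B=x_1B+x_2B$. Then the sequence $$0\longrightarrow B(-2)\xrightarrow{d_2^{(x)}}B(-1)^2\xrightarrow{d_1^{(x)}}B\longrightarrow M_x\longrightarrow 0,$$ where $$d_1^{(x)}(u,v)=ux_1+vx_2,\qquad d_2^{(x)}(w)=(wx_2,\;wx_1),$$ is a minimal graded free resolution of $M_x$. In particular, $$\beta_{0,0}^B(M_x)=1,\quad \beta_{1,1}^B(M_x)=2,\quad \beta_{2,2}^B(M_x)=1,$$ and all other graded Betti numbers of $M_x$ vanish.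
   Context: All modules are finitely generated graded right $B$-modules. $B=\bigoplus_{n\ge0}B_n$ is graded with $x_1,x_2,y_1,y_2$ in degree $1$, and $B_{\ge1}=\bigoplus_{n\ge1}B_n$. $B(-j)$ denotes the degree shift of $B$, the free right module of rank one with generator in degree $j$. A graded free resolution of a graded right $B$-module $M$ is an exact complex $\cdots\to F_1\xrightarrow{d_1}F_0\to M\to0$ with each $F_i$ a graded free right $B$-module; it is minimal if $d_i(F_i)\subseteq F_{i-1}B_{\ge1}$ for all $i\ge1$. The graded Betti numbers are $\beta_{i,j}^B(M)=\dim_\Bbbk\operatorname{Tor}_i^B(M,\Bbbk)_j$; equivalently, in the minimal graded free resolution $F_i\cong\bigoplus_j B(-j)^{\beta_{i,j}^B(M)}$.
   Formalization: The printed d_1, d_2 are left- but not right-B-linear; proved instead: d_1(u,v)=x_1u+x_2v, d_2(w)=(x_2w,x_1w) resolve the right module M_x, the printed maps resolve the left module B/(Bx_1+Bx_2), and x_1B+x_2B=Bx_1+Bx_2. *)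

(* Defs.v *)
From HB Require Import structures.
From mathcomp Require Import all_boot all_order all_algebra.
From mathcomp Require Import boolp.
From mathcomp.multinomials Require Import monalg.

Set Implicit Arguments.
Unset Strict Implicit.
Unset Printing Implicit Defensive.

Import GRing.Theory.

Local Open Scope ring_scope.
Local Open Scope quotient_scope.

Section QuotientModule.
Variables (A : pzRingType) (V : lmodType A) (W : submodClosed V).

Definition qmod_pred : pred V := fun v => v \in W.

Fact qmod_pred_zmod : zmod_closed qmod_pred.
Proof.
split=> [|v w]; rewrite -!topredE /= /qmod_pred ?rpred0 // => Wv Ww.
by rewrite -scaleN1r rpredD ?rpredZ.
Qed.

HB.instance Definition _ := GRing.isZmodClosed.Build V qmod_pred qmod_pred_zmod.

Definition qmod := Quotient.quot (GRing.ZmodClosed.clone V qmod_pred _).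

HB.instance Definition _ := GRing.Zmodule.on qmod.
HB.instance Definition _ := ZmodQuotient.on qmod.

Definition qmod_pi (v : V) : qmod := \pi_qmod v.

Definition qmod_scale (a : A) (m : qmod) : qmod := qmod_pi (a *: repr m).

Lemma qmod_piE v w : (qmod_pi v == qmod_pi w) = (v - w \in W).
Proof. by rewrite -[RHS]/(v - w \in qmod_pred) Quotient.idealrBE. Qed.

Lemma qmod_reprK m : qmod_pi (repr m) = m.
Proof. exact: reprK. Qed.

Lemma qmod_piD v w : qmod_pi (v + w) = qmod_pi v + qmod_pi w.
Proof. by rewrite /qmod_pi !piE. Qed.

Lemma qmod_piZ a v : qmod_scale a (qmod_pi v) = qmod_pi (a *: v).
Proof.
apply/eqP; rewrite qmod_piE -scalerBr rpredZ // -qmod_piE.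
by rewrite qmod_reprK.
Qed.

Fact qmod_scaleA a b m : qmod_scale a (qmod_scale b m) = qmod_scale (a * b) m.
Proof. by rewrite -[m]qmod_reprK !qmod_piZ scalerA. Qed.

Fact qmod_scale1 : left_id 1 qmod_scale.
Proof. by move=> m; rewrite -[m]qmod_reprK !qmod_piZ scale1r. Qed.

Fact qmod_scaleDr : right_distributive qmod_scale +%R.
Proof.
move=> a m n; rewrite -[m]qmod_reprK -[n]qmod_reprK -qmod_piD !qmod_piZ.
by rewrite scalerDr qmod_piD.
Qed.

Fact qmod_scaleDl m : {morph qmod_scale^~ m : a b / a + b}.
Proof. by move=> a b /=; rewrite -[m]qmod_reprK !qmod_piZ scalerDl qmod_piD. Qed.

HB.instance Definition _ := GRing.Zmodule_isLmodule.Build A qmod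
  qmod_scaleA qmod_scale1 qmod_scaleDr qmod_scaleDl.

End QuotientModule.

Section AlgebraBK.
Variables (k : fieldType) (alpha : k).

(* The free algebra k<X1,X2,Y1,Y2>, the letters 0,1,2,3 being X1,X2,Y1,Y2. *)
Local Notation freeBK := {malg k[{fmonom 'I_4}]}.

Definition letter (i : 'I_4) : freeBK := << fmu i >>.

Local Notation X1 := (letter (inord 0)).
Local Notation X2 := (letter (inord 1)).
Local Notation Y1 := (letter (inord 2)).
Local Notation Y2 := (letter (inord 3)).

Definition relsBK : seq freeBK :=
  [:: X2 * X1 + X1 * X2;
      Y2 * Y1 + Y1 * Y2;
      Y1 * X1 - X1 * Y1;
      Y1 * X2 - X2 * Y2;
      Y2 * X1 - X1 * Y2;
      Y2 * X2 - alpha *: (X2 * Y1)].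

(* The two-sided ideal generated by the relations. *)
Definition idealBK : pred freeBK := fun f =>
  `[< exists2 s : seq (freeBK * freeBK * freeBK),
        {in s, forall t, t.1.2 \in relsBK}
        & f = \sum_(t <- s) t.1.1 * t.1.2 * t.2 >].

Lemma idealBK0 : idealBK 0.
Proof. by apply/asboolP; exists [::]; rewrite ?big_nil. Qed.

Lemma idealBKD f g : idealBK f -> idealBK g -> idealBK (f + g).
Proof.
move=> /asboolP[s sP ->] /asboolP[t tP ->]; apply/asboolP; exists (s ++ t).
  by move=> u; rewrite mem_cat => /orP[/sP|/tP].
by rewrite big_cat.
Qed.

Lemma idealBKMl u f : idealBK f -> idealBK (u * f).
Proof.
move=> /asboolP[s sP ->]; apply/asboolP.
exists [seq (u * t.1.1, t.1.2, t.2) | t <- s].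
  by move=> _ /mapP[t ts ->] /=; apply: sP.
by rewrite big_map mulr_sumr; apply: eq_bigr => t _; rewrite !mulrA.
Qed.

Lemma idealBKMr u f : idealBK f -> idealBK (f * u).
Proof.
move=> /asboolP[s sP ->]; apply/asboolP.
exists [seq (t.1.1, t.1.2, t.2 * u) | t <- s].
  by move=> _ /mapP[t ts ->] /=; apply: sP.
rewrite big_map.
rewrite mulr_suml.
apply: eq_bigr => t _ /=.
exact: (esym (mulrA _ _ _)).
Qed.

Fact idealBK_zmod : zmod_closed idealBK.
Proof.
split=> [|f g If Ig]; first exact: idealBK0.
by apply: idealBKD => //; rewrite -mulN1r; apply: idealBKMl.
Qed.

HB.instance Definition _ := GRing.isZmodClosed.Build freeBK idealBK idealBK_zmod.

Definition BK := Quotient.quot (GRing.ZmodClosed.clone freeBK idealBK _).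

HB.instance Definition _ := GRing.Zmodule.on BK.
HB.instance Definition _ := ZmodQuotient.on BK.

Definition BK_pi (f : freeBK) : BK := \pi_BK f.

Lemma BK_piE f g : (BK_pi f == BK_pi g) = idealBK (f - g).
Proof. by rewrite -[RHS]/(f - g \in idealBK) Quotient.idealrBE. Qed.

Lemma BK_reprK b : BK_pi (repr b) = b.
Proof. exact: reprK. Qed.

Lemma BK_piD f g : BK_pi (f + g) = BK_pi f + BK_pi g.
Proof. by rewrite /BK_pi !piE. Qed.

Lemma BK_repr f : idealBK (repr (BK_pi f) - f).
Proof. by rewrite -BK_piE BK_reprK. Qed.

Definition BK_one : BK := BK_pi 1.
Definition BK_mul (a b : BK) : BK := BK_pi (repr a * repr b).
Definition BK_scale (c : k) (b : BK) : BK := BK_pi (c *: repr b).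

Lemma BK_piM f g : BK_mul (BK_pi f) (BK_pi g) = BK_pi (f * g).
Proof.
apply/eqP; rewrite BK_piE; set f' := repr (BK_pi f); set g' := repr (BK_pi g).
have -> : f' * g' - f * g = f' * (g' - g) + (f' - f) * g.
  by rewrite mulrBr mulrBl addrA subrK.
by apply: idealBKD; [apply: idealBKMl|apply: idealBKMr]; apply: BK_repr.
Qed.

Lemma BK_piZ c f : BK_scale c (BK_pi f) = BK_pi (c *: f).
Proof.
apply/eqP; rewrite BK_piE -scalerBr -mul_malgC.
by apply: idealBKMl; apply: BK_repr.
Qed.

Fact BK_mulA : associative BK_mul.
Proof.
move=> a b c; rewrite -[a]BK_reprK -[b]BK_reprK -[c]BK_reprK.
by rewrite !BK_piM mulrA.
Qed.

Fact BK_mul1l : left_id BK_one BK_mul.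
Proof. by move=> a; rewrite -[a]BK_reprK BK_piM mul1r. Qed.

Fact BK_mul1r : right_id BK_one BK_mul.
Proof. by move=> a; rewrite -[a]BK_reprK BK_piM mulr1. Qed.

Fact BK_mulDl : left_distributive BK_mul +%R.
Proof.
move=> a b c; rewrite -[a]BK_reprK -[b]BK_reprK -[c]BK_reprK.
by rewrite -BK_piD !BK_piM mulrDl BK_piD.
Qed.

Fact BK_mulDr : right_distributive BK_mul +%R.
Proof.
move=> a b c; rewrite -[a]BK_reprK -[b]BK_reprK -[c]BK_reprK.
by rewrite -BK_piD !BK_piM mulrDr BK_piD.
Qed.

Fact BK_1_neq0 : BK_one != 0.
Proof.
have -> : 0 = BK_pi 0 by rewrite /BK_pi !piE.
rewrite BK_piE subr0; apply/negP => /asboolP[s sP eq1].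
pose eps : freeBK -> k := @mcoeff {fmonom 'I_4} k mone.
have [epsM eps1] : multiplicative eps := @mcoeff1g_is_multiplicative _ _.
suff: eps 1 = 0 by rewrite eps1; move/eqP; rewrite oner_eq0.
have eps0D f g : eps f = 0 -> eps g = 0 -> eps (f + g) = 0.
  by move=> f0 g0; rewrite [LHS]mcoeffD -/(eps f) -/(eps g) f0 g0 addr0.
have eps0B f g : eps f = 0 -> eps g = 0 -> eps (f - g) = 0.
  by move=> f0 g0; rewrite [LHS]mcoeffB -/(eps f) -/(eps g) f0 g0 subr0.
have eps0Z c f : eps f = 0 -> eps (c *: f) = 0.
  by move=> f0; rewrite [LHS]mcoeffZ -/(eps f) f0 mulr0.
have eps0M i j : eps (letter i * letter j) = 0.
  rewrite epsM [X in X * _]mcoeffU1; case: eqP; last by rewrite mul0r.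
  by move=> /(congr1 (@fmonom_val _)); rewrite fm1 fmuE.
rewrite eq1 [LHS]raddf_sum /= big_seq big1 // => t /sP rt.
rewrite -[LHS]/(eps _); clearbody eps.
suff eps_rel : all (fun r => eps r == 0) relsBK.
  by rewrite !epsM (eqP (allP eps_rel _ rt)) mulr0 mul0r.
have and0 (b : bool) f : eps f = 0 -> b -> (eps f == 0) && b.
  by move=> -> ->; rewrite eqxx.
apply: (@and0); first by apply: eps0D; apply: eps0M.
apply: (@and0); first by apply: eps0D; apply: eps0M.
do 3![apply: (@and0); first by apply: eps0B; apply: eps0M].
by apply: (@and0); first by apply: eps0B; [|apply: eps0Z]; apply: eps0M.
Qed.

HB.instance Definition _ := GRing.Zmodule_isNzRing.Build BK
  BK_mulA BK_mul1l BK_mul1r BK_mulDl BK_mulDr BK_1_neq0.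

Fact BK_scaleA a b m : BK_scale a (BK_scale b m) = BK_scale (a * b) m.
Proof. by rewrite -[m]BK_reprK !BK_piZ scalerA. Qed.

Fact BK_scale1 : left_id 1 BK_scale.
Proof. by move=> m; rewrite -[m]BK_reprK !BK_piZ scale1r. Qed.

Fact BK_scaleDr : right_distributive BK_scale +%R.
Proof.
move=> a m n; rewrite -[m]BK_reprK -[n]BK_reprK -BK_piD !BK_piZ.
by rewrite scalerDr BK_piD.
Qed.

Fact BK_scaleDl m : {morph BK_scale^~ m : a b / a + b}.
Proof. by move=> a b /=; rewrite -[m]BK_reprK !BK_piZ scalerDl BK_piD. Qed.

HB.instance Definition _ := GRing.Zmodule_isLmodule.Build k BK
  BK_scaleA BK_scale1 BK_scaleDr BK_scaleDl.

Fact BK_scaleAl (c : k) (a b : BK) :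
  BK_scale c (BK_mul a b) = BK_mul (BK_scale c a) b.
Proof.
rewrite -[a]BK_reprK -[b]BK_reprK.
by rewrite !(BK_piM, BK_piZ) scalerAl.
Qed.

HB.instance Definition _ := GRing.Lmodule_isLalgebra.Build k BK BK_scaleAl.

Lemma freeBK_scaleAr (c : k) (f g : freeBK) : c *: (f * g) = f * (c *: g).
Proof.
have cC : c%:MP * f = f * c%:MP.
  rewrite malgM_def fgmulUg [RHS]fgmulgU.
  by apply: eq_bigr => m _; rewrite mul1m mulm1 mulrC.
rewrite -(mul_malgC c (f * g)) -(mul_malgC c g).
by apply: etrans (mulrA _ _ _) _; rewrite cC; apply: esym (mulrA _ _ _).
Qed.

Fact BK_scaleAr (c : k) (a b : BK) :
  BK_scale c (BK_mul a b) = BK_mul a (BK_scale c b).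
Proof.
rewrite -[a]BK_reprK -[b]BK_reprK.
by rewrite !(BK_piM, BK_piZ) freeBK_scaleAr.
Qed.

HB.instance Definition _ := GRing.Lalgebra_isAlgebra.Build k BK BK_scaleAr.

Definition genBK (i : 'I_4) : BK := BK_pi (letter i).
Definition BKx1 : BK := genBK (inord 0).
Definition BKx2 : BK := genBK (inord 1).
Definition BKy1 : BK := genBK (inord 2).
Definition BKy2 : BK := genBK (inord 3).

(* B_j is the k-span of the words of length j in the generators; in
   particular B_j = 0 for j < 0. *)
Definition BKdeg (j : int) (b : BK) : Prop :=
  exists2 s : seq (k * seq 'I_4),
    {in s, forall t, (size t.2)%:Z = j}
    & b = \sum_(t <- s) t.1 *: \prod_(i <- t.2) genBK i.

End AlgebraBK.

(* Left modules over a ring A with a family of homogeneous parts Adeg.  Graded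
   right B-modules are obtained with A := B^c, the opposite ring: for
   b : B^c, the element b *: m is m b. *)
Section GradedModules.
Variables (A : nzRingType) (Adeg : int -> A -> Prop).

Record gmod := GMod {
  gmod_sort :> lmodType A;
  gdeg : int -> gmod_sort -> Prop
}.

Record is_graded (V : gmod) : Prop := IsGraded {
  gdeg0 : forall j, gdeg j (0 : V);
  gdegB : forall j (v w : V), gdeg j v -> gdeg j w -> gdeg j (v - w);
  gdegZ : forall i j a (v : V), Adeg i a -> gdeg j v -> gdeg (i + j) (a *: v);
  gdeg_span : forall v : V, exists (s : seq int) (f : int -> V),
    (forall j, gdeg j (f j)) /\ v = \sum_(j <- s) f j;
  gdeg_direct : forall (s : seq int) (f : int -> V), uniq s ->
    (forall j, gdeg j (f j)) -> \sum_(j <- s) f j = 0 ->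
    {in s, forall j, f j = 0}
}.

Definition graded_hom (V W : gmod) (f : V -> W) : Prop :=
  linear f /\ forall j v, gdeg j v -> gdeg j (f v).

(* Finite rank, as all modules are finitely generated: V is isomorphic to the
   direct sum of the A(- deg i). *)
Definition graded_free (V : gmod) : Prop :=
  exists (n : nat) (deg : 'I_n -> int) (e : 'I_n -> V),
    (forall i, gdeg (deg i) (e i)) /\
    forall v : V, exists! a : {ffun 'I_n -> A}, v = \sum_i a i *: e i.

Definition regular_gmod : gmod := @GMod A^o Adeg.

(* Degree shift by -j: the generator of regular_gmod moves to degree j. *)
Definition shift (V : gmod) (j : int) : gmod :=
  @GMod V (fun i v => gdeg (i - j) v).

Definition gsum (V W : gmod) : gmod :=
  @GMod (V * W)%type (fun j p => gdeg j p.1 /\ gdeg j p.2).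

Definition gzero : gmod := @GMod 'rV[A]_0 (fun _ _ => True).

Definition gquot (V : gmod) (W : submodClosed V) : gmod :=
  @GMod (qmod W) (fun j m => exists2 v : V, gdeg j v & m = qmod_pi W v).

(* The ideal A_{>=1}. *)
Definition aug_ideal (a : A) : Prop :=
  exists (n : nat) (f : int -> A),
    (forall j, Adeg j (f j)) /\ a = \sum_(1 <= i < n) f i%:Z.

(* The submodule generated by the action of A_{>=1}: V B_{>=1} for a right
   B-module V. *)
Definition aug_sub (V : gmod) (v : V) : Prop :=
  exists2 s : seq (A * V),
    {in s, forall t, aug_ideal t.1} & v = \sum_(t <- s) t.1 *: t.2.

Section Resolution.
Variables (M : gmod) (F : nat -> gmod).
Variables (d : forall i, F i.+1 -> F i) (eps : F 0 -> M).

Record graded_free_resolution : Prop := GradedFreeResolution {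
  res_graded_target : is_graded M;
  res_graded : forall i, is_graded (F i);
  res_free : forall i, graded_free (F i);
  res_hom : forall i, graded_hom (@d i);
  res_hom_eps : graded_hom eps;
  res_surj : forall m, exists x, eps x = m;
  res_exact0 : forall x, eps x = 0 <-> exists y, d y = x;
  res_exact : forall i (x : F i.+1), d x = 0 <-> exists y, d y = x
}.

Definition minimal_graded_free_resolution : Prop :=
  graded_free_resolution /\ forall i (x : F i.+1), aug_sub (d x).

End Resolution.

(* The left ideal A a + A b; when A is the opposite ring B^c this is the right
   ideal a B + b B of B. *)
Definition ideal2 (a b : A) : pred A^o := fun c =>
  `[< exists u v : A, c = u * a + v * b >].

Fact ideal2_submod (a b : A) : submod_closed (ideal2 a b).
Proof.
split; first by apply/asboolP; exists 0, 0; rewrite !mul0r addr0.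
move=> c x y /asboolP[u [v ->]] /asboolP[u' [v' ->]]; apply/asboolP.
exists (c * u + u'), (c * v + v').
rewrite !mulrDl -!mulrA addrACA; congr (_ + _).
by rewrite [LHS]mulrDr.
Qed.

HB.instance Definition _ (a b : A) :=
  GRing.isSubmodClosed.Build A A^o (ideal2 a b) (ideal2_submod a b).

Definition ideal2_submodule (a b : A) : submodClosed A^o :=
  GRing.SubmodClosed.clone A A^o (ideal2 a b) _.

(* A/(A a + A b), i.e. B/(aB + bB) when A = B^c. *)
Definition quot2 (a b : A) : gmod :=
  @gquot regular_gmod (ideal2_submodule a b).

Definition quot2_pi (a b : A) : A -> quot2 a b :=
  qmod_pi (ideal2_submodule a b).

(* The terms of 0 -> A(-2) -> A(-1)^2 -> A, continued by zero. *)
Definition koszul_mod (i : nat) : gmod :=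
  match i with
  | 0 => regular_gmod
  | 1 => gsum (shift regular_gmod 1) (shift regular_gmod 1)
  | 2 => shift regular_gmod 2
  | _ => gzero
  end.

Definition koszul_d (d1 : A * A -> A) (d2 : A -> A * A) (i : nat) :
  koszul_mod i.+1 -> koszul_mod i :=
  match i return koszul_mod i.+1 -> koszul_mod i with
  | 0 => d1
  | 1 => d2
  | _ => fun _ => 0
  end.

End GradedModules.

Arguments koszul_d {A} Adeg d1 d2 i.

Section Betti.
Variables (k : fieldType) (B : algType k) (Bdeg : int -> B -> Prop).

Local Notation gmodr := (gmod B^c).

(* dim_k (Z / (Z :&: W)) = n, for k-subspaces Z and W of V. *)
Definition quot_dim (V : lmodType B^c) (Z W : V -> Prop) (n : nat) : Prop :=
  exists e : 'I_n -> V, (forall i, Z (e i)) /\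
    forall z, Z z -> exists! c : {ffun 'I_n -> k},
      W (z - \sum_i (((c i)%:A : B) : B^c) *: e i).

(* The homology in homological degree i and internal degree j of the complex
   F (x)_B k has dimension n.  Since k = B/B_{>=1}, its terms are
   F_i (x)_B k = F_i / F_i B_{>=1}; cycles and boundaries are expressed on
   homogeneous representatives in F_i. *)
Definition tor_cycle (F : nat -> gmodr) (d : forall i, F i.+1 -> F i)
    (i : nat) : F i -> Prop :=
  match i with
  | 0 => fun=> True
  | i'.+1 => fun x => aug_sub (Bdeg : int -> B^c -> Prop) (d i' x)
  end.

Definition tor_dim (F : nat -> gmodr) (d : forall i, F i.+1 -> F i)
    (i : nat) (j : int) (n : nat) : Prop :=
  quot_dim
    (fun x : F i => gdeg j x /\ tor_cycle d x)
    (fun x : F i => exists2 y : F i.+1,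
       gdeg j y & aug_sub (Bdeg : int -> B^c -> Prop) (x - d i y))
    n.

(* dim_k Tor_i^B(M, k)_j = n, computed by any graded free resolution of the
   graded right B-module M. *)
Definition graded_betti (M : gmodr) (i : nat) (j : int) (n : nat) : Prop :=
  (exists (F : nat -> gmodr) (d : forall i, F i.+1 -> F i) (eps : F 0 -> M),
     graded_free_resolution (Bdeg : int -> B^c -> Prop) d eps) /\
  forall (F : nat -> gmodr) (d : forall i, F i.+1 -> F i) (eps : F 0 -> M),
    graded_free_resolution (Bdeg : int -> B^c -> Prop) d eps ->
    tor_dim d i j n.

End Betti.

(* Main.v *)
Require Import Defs.
From HB Require Import structures.
From mathcomp Require Import all_boot all_order all_algebra.
From mathcomp Require Import boolp finmap zify ring.
From mathcomp.multinomials Require Import monalg.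

Set Implicit Arguments.
Unset Strict Implicit.
Unset Printing Implicit Defensive.

Import Order.TTheory GRing.Theory Num.Theory.

Local Open Scope ring_scope.

(** The algebra B has the normal monomials x1^a x2^b y1^c y2^d as a basis, and
    on this basis the multiplications by x1 and x2, from the left or from the
    right, send each monomial to a nonzero multiple of a monomial. Exactness of
    the complex thus becomes a statement about two anticommuting monomial
    operators, proved by splitting off the monomials divisible by x2
    ([mop_exact]). To see that the normal monomials are independent, the
    generators are made to act on the space with that basis by the formulas that
    multiplication would give; the six relations hold for these operators, so B
    acts ([orbit_map]), and b |-> b . 1 is inverse to the expansion of normal
    forms into products ([nfK], [expandK]).

    The right module B / (x1 B + x2 B) is handled as a left module over the
    opposite ring, so that one lemma ([koszul_resolution]) gives its resolution
    from left multiplications and that of B / (B x1 + B x2) from right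
    multiplications. The right ideal x1 B + x2 B and the left ideal
    B x1 + B x2 coincide because x1 and x2 are normal elements.

    The Betti numbers are those of an arbitrary graded free resolution, so they
    require the independence of Tor from the resolution. Comparison maps and
    homotopies between graded free resolutions ([comparison], [null_homotopy])
    transport a basis of the generators of a minimal resolution to a basis of
    Tor ([tor_dim_from_minimal]), and the i-th term of the complex has all its
    generators in degree i ([koszul_basis]), where [quot_dim_free] counts
    them. *)

(** * Linearity as a predicate, and dependent choice along the naturals *)

(** Morphisms of graded modules are bare functions with a proof of [linear];
    packing them locally gives access to the theory of bundled morphisms. *)
Section LinearPredicate.
Variables (A : nzRingType) (V W : lmodType A) (f : V -> W).
Hypothesis fL : linear f.

Let g : {linear V -> W} := HB.pack f (GRing.isLinear.Build A V W *:%R f fL).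

Lemma linear_fun0 : f 0 = 0. Proof. exact: (raddf0 g). Qed.
Lemma linear_funD x y : f (x + y) = f x + f y. Proof. exact: (raddfD g). Qed.
Lemma linear_funB x y : f (x - y) = f x - f y. Proof. exact: (raddfB g). Qed.
Lemma linear_funZ a x : f (a *: x) = a *: f x. Proof. exact: (linearZ_LR g). Qed.
Lemma linear_fun_sum I (r : seq I) (F : I -> V) :
  f (\sum_(i <- r) F i) = \sum_(i <- r) f (F i).
Proof. exact: (raddf_sum g). Qed.

End LinearPredicate.

(** Chain maps and homotopies are built degree by degree in a family of types
    indexed by the homological degree. The invariant [G] carries the lifting
    condition that makes the next step possible. *)
Lemma dependent_choice_nat (T : nat -> Type) (G : forall i, T i -> Prop)
    (R : forall i, T i -> T i.+1 -> Prop) (x0 : T 0%N) :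
  G 0%N x0 -> (forall i x, G i x -> exists y, G i.+1 y /\ R i x y) ->
  exists f : forall i, T i,
    [/\ f 0%N = x0, forall i, G i (f i) & forall i, R i (f i) (f i.+1)].
Proof.
move=> G0 GR.
pose next i (x : {x : T i | G i x}) := cid (GR i (sval x) (svalP x)).
pose F := fix F i : {x : T i | G i x} :=
  match i with
  | 0 => exist _ x0 G0
  | i'.+1 => exist _ (sval (next i' (F i'))) (proj1 (svalP (next i' (F i'))))
  end.
exists (fun i => sval (F i)); split=> // i; first exact: svalP.
exact: (proj2 (svalP (next i (F i)))).
Qed.

(** * Graded modules: homogeneous components, coordinates and liftings *)

Section GradedHomological.
Variables (A : nzRingType) (Adeg : int -> A -> Prop).
Local Notation gmod := (gmod A).
Local Notation is_graded := (is_graded Adeg).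

Section Components.
Variables (V : gmod) (Vgr : is_graded V).

Let gdegN j (v : V) : gdeg j v -> gdeg j (- v).
Proof.
by move=> vj; rewrite -sub0r; apply: (gdegB Vgr) => //; apply: gdeg0 Vgr _.
Qed.

Lemma gdegD j (v w : V) : gdeg j v -> gdeg j w -> gdeg j (v + w).
Proof.
by move=> vj wj; rewrite -[w]opprK; apply: (gdegB Vgr) => //; apply: gdegN.
Qed.

Lemma gdeg_sum I (r : seq I) j (F : I -> V) :
  (forall i, gdeg j (F i)) -> gdeg j (\sum_(i <- r) F i).
Proof.
move=> Fj; elim: r => [|i r IH]; first by rewrite big_nil; apply: gdeg0 Vgr _.
by rewrite big_cons; apply: gdegD.
Qed.

(** The decomposition of a vector as a function with finite support, which is
    unique, unlike the list of degrees and parts of a presentation. *)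
Definition decomposes (v : V) (f : int -> V) : Prop :=
  (forall j, gdeg j (f j)) /\
  exists s : seq int, [/\ uniq s, forall j, j \notin s -> f j = 0
    & v = \sum_(j <- s) f j].

Lemma sum_supported (s t : seq int) (f : int -> V) :
  uniq s -> uniq t -> (forall j, j \notin s -> f j = 0) -> {subset s <= t} ->
  \sum_(j <- t) f j = \sum_(j <- s) f j.
Proof.
move=> us ut f0 st; rewrite (bigID (mem s)) /= [X in _ + X]big1 ?addr0.
  rewrite -big_filter; apply: perm_big; apply: uniq_perm; rewrite ?filter_uniq //.
  by move=> j; rewrite mem_filter; case: (boolP (j \in s)) => //= /st ->.
by move=> j /f0.
Qed.

Lemma decomposes_uniq v f g : decomposes v f -> decomposes v g -> f = g.
Proof.
move=> [fd [s [us f0 vs]]] [gd [t [ut g0 vt]]].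
have ust : uniq (undup (s ++ t)) by apply: undup_uniq.
have sst : {subset s <= undup (s ++ t)}.
  by move=> j js; rewrite mem_undup mem_cat js.
have tst : {subset t <= undup (s ++ t)}.
  by move=> j jt; rewrite mem_undup mem_cat jt orbT.
apply/funext => j; apply/eqP; rewrite -subr_eq0; apply/eqP.
have [jst|jst] := boolP (j \in undup (s ++ t)); last first.
  move: jst; rewrite mem_undup mem_cat negb_or => /andP[/f0-> /g0->].
  by rewrite subr0.
apply: (gdeg_direct Vgr ust _ _ jst (f := fun j => f j - g j)).
  by move=> l; apply: (gdegB Vgr).
rewrite sumrB (sum_supported us ust f0 sst) (sum_supported ut ust g0 tst).
by rewrite -vs -vt subrr.
Qed.

Lemma decomposes_exists v : exists f, decomposes v f.
Proof.
have [s [f [fd ->]]] := gdeg_span Vgr v.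
(* A degree may be listed several times, and then contributes each time. *)
exists (fun j => f j *+ count_mem j s); split=> [j|].
  elim: (count_mem j s) => [|m IH]; first exact: gdeg0 Vgr _.
  by rewrite mulrS; apply: gdegD.
exists (undup s); split; first exact: undup_uniq.
  by move=> j; rewrite mem_undup => /count_memPn->.
exact: (esym (big_undup_iterop_count _ s xpredT f)).
Qed.

Definition hcomp (j : int) (v : V) : V := sval (cid (decomposes_exists v)) j.

Lemma hcompP v : decomposes v (hcomp^~ v).
Proof. exact: (svalP (cid (decomposes_exists v))). Qed.

Lemma hcompE v f j : decomposes v f -> hcomp j v = f j.
Proof. by move/(decomposes_uniq (hcompP v)) <-. Qed.

Lemma hcomp_deg j v : gdeg j (hcomp j v).
Proof. exact: (proj1 (hcompP v)). Qed.

Lemma hcomp_sum v : exists s : seq int, v = \sum_(j <- s) hcomp j v.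
Proof. by have [_ [s [_ _]]] := hcompP v; exists s. Qed.

Lemma hcompD j v w : hcomp j (v + w) = hcomp j v + hcomp j w.
Proof.
apply: (hcompE (f := fun j => hcomp j v + hcomp j w)).
have [vd [s [us v0 vs]]] := hcompP v; have [wd [t [ut w0 wt]]] := hcompP w.
split=> [l|]; first by apply: gdegD.
have ust : uniq (undup (s ++ t)) by apply: undup_uniq.
have sst : {subset s <= undup (s ++ t)}.
  by move=> l js; rewrite mem_undup mem_cat js.
have tst : {subset t <= undup (s ++ t)}.
  by move=> l jt; rewrite mem_undup mem_cat jt orbT.
exists (undup (s ++ t)); split=> // [l|].
  by rewrite mem_undup mem_cat negb_or => /andP[/v0-> /w0->]; rewrite addr0.
rewrite big_split /= (sum_supported us ust v0 sst) (sum_supported ut ust w0 tst).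
by rewrite -vs -wt.
Qed.

Lemma hcomp_homog i j v : gdeg i v -> hcomp j v = if i == j then v else 0.
Proof.
move=> vi; apply: (hcompE (f := fun j => if i == j then v else 0)); split.
  by move=> l; case: eqP => [<- //|_]; apply: gdeg0 Vgr _.
exists [:: i]; split=> // [l|]; last by rewrite big_seq1 eqxx.
by rewrite inE eq_sym => /negbTE->.
Qed.

Lemma hcomp_id j v : gdeg j v -> hcomp j v = v.
Proof. by move/(hcomp_homog j); rewrite eqxx. Qed.

Lemma hcomp0 j : hcomp j 0 = 0.
Proof. by apply: hcomp_id; apply: gdeg0 Vgr _. Qed.

Lemma hcomp_bigsum j I (r : seq I) (F : I -> V) :
  hcomp j (\sum_(i <- r) F i) = \sum_(i <- r) hcomp j (F i).
Proof. by apply: (big_morph _ (hcompD j)); apply: hcomp0. Qed.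

End Components.

(** By additivity it is enough to look at a homogeneous vector, where both
    sides are either zero or the image of the vector. *)
Lemma hcomp_hom (V W : gmod) (Vgr : is_graded V) (Wgr : is_graded W)
    (f : V -> W) j v :
  graded_hom f -> f (hcomp Vgr j v) = hcomp Wgr j (f v).
Proof.
move=> [fL fd]; have [s vs] := hcomp_sum Vgr v.
rewrite {2}vs (linear_fun_sum fL) hcomp_bigsum {1}vs hcomp_bigsum (linear_fun_sum fL).
apply: eq_bigr => i _.
have vi := hcomp_deg Vgr i v.
rewrite (hcomp_homog _ _ vi) (hcomp_homog _ _ (fd _ _ vi)).
by case: eqP => // _; rewrite linear_fun0.
Qed.

(** A graded map commutes with taking components, so the component of degree
    [j] of any preimage is again a preimage. *)
Lemma homogeneous_preimage (V W : gmod) (f : V -> W) j (y : W) :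
  is_graded V -> is_graded W -> graded_hom f -> gdeg j y ->
  (exists x, f x = y) -> exists x, gdeg j x /\ f x = y.
Proof.
move=> Vgr Wgr fh yj [x fx]; exists (hcomp Vgr j x); split.
  exact: hcomp_deg.
by rewrite (hcomp_hom Vgr Wgr) // fx hcomp_id.
Qed.

Hypothesis Agr : is_graded (regular_gmod Adeg).

Lemma hcomp_scale (V : gmod) (Vgr : is_graded V) (a : A) i j (v : V) :
  gdeg i v -> hcomp Vgr j (a *: v) = hcomp Agr (j - i) a *: v.
Proof.
move=> vi; have [s sE] := hcomp_sum Agr a.
rewrite sE scaler_suml !hcomp_bigsum scaler_suml; apply: eq_bigr => l _.
have al := hcomp_deg Agr l a.
rewrite (hcomp_homog _ _ al) (hcomp_homog Vgr _ (gdegZ Vgr al vi)).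
have -> : (l + i == j) = (l == j - i) by rewrite -subr_eq opprK.
by case: eqP => // _; rewrite scale0r.
Qed.

Section FreeModules.
Variables (P : gmod) (n : nat) (deg : 'I_n -> int) (e : 'I_n -> P).
Hypothesis edeg : forall i, gdeg (deg i) (e i).
Hypothesis efree : forall v : P,
  exists! a : {ffun 'I_n -> A}, v = \sum_i a i *: e i.

Definition free_coord (v : P) (i : 'I_n) : A := sval (cid (efree v)) i.

Lemma free_coordE v : v = \sum_i free_coord v i *: e i.
Proof. exact: (proj1 (svalP (cid (efree v)))). Qed.

Lemma free_coord_uniq v (a : 'I_n -> A) :
  v = \sum_i a i *: e i -> free_coord v =1 a.
Proof.
move=> va i; have [_ u] := svalP (cid (efree v)).
suff: sval (cid (efree v)) = finfun a by rewrite /free_coord => ->; rewrite ffunE.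
by apply: u; rewrite {1}va; apply: eq_bigr => l _; rewrite ffunE.
Qed.

Lemma free_coordZD c v w i :
  free_coord (c *: v + w) i = c * free_coord v i + free_coord w i.
Proof.
apply: (@free_coord_uniq (c *: v + w)
  (fun i => c * free_coord v i + free_coord w i)).
under eq_bigr do rewrite scalerDl -scalerA.
by rewrite big_split /= -scaler_sumr -!free_coordE.
Qed.

Lemma free_coord_linear i : linear (fun v => free_coord v i : A^o).
Proof. by move=> c v w; apply: free_coordZD. Qed.

(** Replacing each coordinate by its component of the expected degree gives
    another expansion of the same homogeneous vector, so uniqueness of the
    coordinates forces equality. *)
Lemma free_coord_deg (Pgr : is_graded P) v j i :
  gdeg j v -> Adeg (j - deg i) (free_coord v i).
Proof.
move=> vj.
rewrite (@free_coord_uniq v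
  (fun i => hcomp Agr (j - deg i) (free_coord v i))).
  exact: (hcomp_deg Agr).
rewrite -{1}(hcomp_id Pgr vj) {1}(free_coordE v) hcomp_bigsum.
by apply: eq_bigr => l _; apply: hcomp_scale.
Qed.

End FreeModules.

(** Projectivity of graded free modules, with control of the degrees: the
    image of each basis vector is lifted to a homogeneous element of the
    degree of that vector. *)
Lemma graded_lift (P Q Q' : gmod) (f : P -> Q) (d : Q' -> Q) :
  graded_free P -> is_graded P -> is_graded Q -> is_graded Q' ->
  graded_hom f -> graded_hom d -> (forall x, exists y, d y = f x) ->
  exists g : P -> Q', graded_hom g /\ forall x, d (g x) = f x.
Proof.
move=> [n [deg [e [edeg efree]]]] Pgr Qgr Q'gr [fL fd] dh fd_im.
have /choice[q qP] : forall i, exists x, gdeg (deg i) x /\ d x = f (e i).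
  by move=> i; apply: homogeneous_preimage => //; apply: fd.
exists (fun v => \sum_i free_coord efree v i *: q i); split; first split.
- move=> c v w; rewrite scaler_sumr -big_split; apply: eq_bigr => i _ /=.
  by rewrite free_coordZD scalerDl scalerA.
- move=> j v vj; apply: gdeg_sum => // i.
  have := gdegZ Q'gr (free_coord_deg edeg efree Pgr i vj) (proj1 (qP i)).
  by rewrite subrK.
move=> x; have [dL _] := dh; rewrite (linear_fun_sum dL) {2}(free_coordE efree x) (linear_fun_sum fL).
by apply: eq_bigr => i _; rewrite !linear_funZ // (proj2 (qP i)).
Qed.


(** * Comparison of graded free resolutions *)

Section AugmentedComplex.
Variables (M : gmod) (F : nat -> gmod).
Variables (d : forall i, F i.+1 -> F i) (eps : F 0 -> M).

(** The resolution with its augmentation put in degree 0 and everything else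
    shifted by one; the inductions can then start from a map of the resolved
    module itself. *)
Definition aug_mod (i : nat) : gmod := if i is i'.+1 then F i' else M.

Definition aug_d (i : nat) : aug_mod i.+1 -> aug_mod i :=
  match i return aug_mod i.+1 -> aug_mod i with
  | 0 => eps
  | i'.+1 => @d i'
  end.

Hypothesis res : graded_free_resolution Adeg d eps.

Lemma aug_mod_graded i : is_graded (aug_mod i).
Proof. by case: i => [|i]; [apply: res_graded_target res|apply: res_graded res _]. Qed.

Lemma aug_d_hom i : graded_hom (@aug_d i).
Proof. by case: i => [|i]; [apply: res_hom_eps res|apply: res_hom res _]. Qed.

Lemma aug_d_exact i x : aug_d x = 0 <-> exists y, @aug_d i.+1 y = x.
Proof. by case: i x => [|i] x; [apply: res_exact0 res _|apply: res_exact res _ _]. Qed.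

Lemma aug_dd i (x : aug_mod i.+2) : aug_d (aug_d x) = 0.
Proof. by apply/aug_d_exact; exists x. Qed.

End AugmentedComplex.

Lemma graded_hom_id (V : gmod) : graded_hom (idfun : V -> V).
Proof. by split=> [c v w|j v vj]. Qed.

Lemma graded_hom_comp (U V W : gmod) (f : V -> W) (g : U -> V) :
  graded_hom f -> graded_hom g -> graded_hom (f \o g).
Proof.
move=> [fL fd] [gL gd]; split=> [c v w|j v vj] /=; last by apply/fd/gd.
by rewrite gL fL.
Qed.

Lemma graded_hom_sub (V W : gmod) (f g : V -> W) : is_graded W ->
  graded_hom f -> graded_hom g -> graded_hom (fun x => f x - g x).
Proof.
move=> Wgr [fL fd] [gL gd]; split=> [c v w|j v vj].
  by rewrite fL gL scalerBr opprD addrACA.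
by apply: (gdegB Wgr); [apply: fd|apply: gd].
Qed.

(** Two resolutions of the same module receive chain maps over the identity:
    exactness of the target is what makes each composite with the differential
    liftable. *)
Lemma comparison (M : gmod) (F G : nat -> gmod)
    (dF : forall i, F i.+1 -> F i) (epsF : F 0%N -> M)
    (dG : forall i, G i.+1 -> G i) (epsG : G 0%N -> M) :
  graded_free_resolution Adeg dF epsF -> graded_free_resolution Adeg dG epsG ->
  exists f : forall i, aug_mod M F i -> aug_mod M G i,
    [/\ f 0%N = idfun, forall i, graded_hom (f i)
      & forall i x, aug_d dG epsG (f i.+1 x) = f i (aug_d dF epsF x)].
Proof.
move=> rF rG.
pose Good i (f : aug_mod M F i -> aug_mod M G i) := graded_hom f /\
  forall x, exists y, aug_d dG epsG (i := i) y = f (aug_d dF epsF x).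
pose Rel i (f : aug_mod M F i -> aug_mod M G i)
    (g : aug_mod M F i.+1 -> aug_mod M G i.+1) :=
  forall x, aug_d dG epsG (g x) = f (aug_d dF epsF x).
have G0 : Good 0%N idfun.
  by split=> [|x]; [apply: graded_hom_id|apply: (res_surj rG)].
have step i f : Good i f -> exists g, Good i.+1 g /\ Rel i f g.
  move=> [fh fim].
  have [g [gh gE]] := graded_lift (res_free rF i) (res_graded rF i)
    (aug_mod_graded rG i) (aug_mod_graded rG i.+1)
    (graded_hom_comp fh (aug_d_hom rF i)) (aug_d_hom rG i) fim.
  exists g; split=> //; split=> // x; apply/(aug_d_exact rG).
  by rewrite gE /= (aug_dd rF) (linear_fun0 (proj1 fh)).
have [f [f0 fG fR]] := dependent_choice_nat G0 step.
by exists f; split=> // i; have [] := fG i.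
Qed.

(** A chain endomorphism that vanishes on the module is homotopic to zero; the
    defect [chi - h d] lands in the cycles, hence in the boundaries, which
    gives the next component of [h]. *)
Lemma null_homotopy (M : gmod) (F : nat -> gmod)
    (d : forall i, F i.+1 -> F i) (eps : F 0%N -> M)
    (chi : forall i, aug_mod M F i -> aug_mod M F i) :
  graded_free_resolution Adeg d eps ->
  (forall i, graded_hom (chi i)) ->
  (forall i x, aug_d d eps (chi i.+1 x) = chi i (aug_d d eps x)) ->
  (forall x, chi 0%N x = 0) ->
  exists h : forall i, aug_mod M F i -> aug_mod M F i.+1,
    [/\ h 0%N = (fun=> 0), forall i, graded_hom (h i)
      & forall i x,
          chi i.+1 x = aug_d d eps (h i.+1 x) + h i (aug_d d eps x)].
Proof.
move=> rF chih chid chi0.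
pose T i := aug_mod M F i -> aug_mod M F i.+1.
pose Good i (h : T i) := graded_hom h /\
  forall x, aug_d d eps (h (aug_d d eps (i := i) x)) = chi i (aug_d d eps x).
pose Rel i (h : T i) (h' : T i.+1) :=
  forall x, chi i.+1 x = aug_d d eps (h' x) + h (aug_d d eps x).
have G0 : Good 0%N (fun=> 0).
  split=> [|x]; last by rewrite chi0 (linear_fun0 (proj1 (aug_d_hom rF 0%N))).
  split=> [c v w|j v vj]; first by rewrite scaler0 addr0.
  exact: gdeg0 (aug_mod_graded rF 1%N) _.
have step i h : Good i h -> exists h', Good i.+1 h' /\ Rel i h h'.
  move=> [hh hE].
  have fh : graded_hom (fun x => chi i.+1 x - h (aug_d d eps x)) :=
    graded_hom_sub (aug_mod_graded rF i.+1) (chih i.+1)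
      (graded_hom_comp hh (aug_d_hom rF i)).
  have fim x : exists y, aug_d d eps (i := i.+1) y = chi i.+1 x - h (aug_d d eps x).
    apply/(aug_d_exact rF); rewrite (linear_funB (proj1 (aug_d_hom rF i))).
    by rewrite hE chid subrr.
  have [h' [h'h h'E]] := graded_lift (res_free rF i) (res_graded rF i)
    (aug_mod_graded rF i.+1) (aug_mod_graded rF i.+2) fh (aug_d_hom rF i.+1) fim.
  exists h'; split=> [|x]; last by rewrite h'E subrK.
  split=> // x; rewrite h'E (aug_dd rF) (linear_fun0 (proj1 hh)).
  by rewrite subr0.
have [h [h0 hG hR]] := dependent_choice_nat G0 step.
by exists h; split=> // i; have [] := hG i.
Qed.

(** * The augmentation ideal and the submodule it generates *)

Section AugmentationIdeal.

Lemma aug_ideal0 : aug_ideal Adeg 0.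
Proof.
by exists 0%N, (fun=> 0); split=> [j|]; [apply: gdeg0 Agr _|rewrite big_geq].
Qed.

(** The two sums are padded with zeros to a common range. *)
Lemma aug_idealD a b :
  aug_ideal Adeg a -> aug_ideal Adeg b -> aug_ideal Adeg (a + b).
Proof.
have pad n N (f : int -> A) : (n <= N)%N ->
    \sum_(1 <= i < n) f i%:Z =
    \sum_(1 <= i < N) (if (i%:Z < n%:Z)%R then f i%:Z else 0).
  move=> nN; rewrite (big_nat_widen _ _ _ _ _ nN) big_mkcond /=.
  by apply: eq_bigr => i _; rewrite ltz_nat.
move=> [n [f [fd ->]]] [m [g [gd ->]]].
exists (maxn n m), (fun j => (if j < n%:Z then f j else 0) +
                             (if j < m%:Z then g j else 0)).
split=> [j|]; last first.
  by rewrite big_split /= -!pad ?leq_maxl ?leq_maxr.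
by apply: (gdegD Agr); case: ifP => _ //; apply: gdeg0 Agr _.
Qed.

Lemma aug_ideal_sum I (r : seq I) (F : I -> A) :
  (forall i, aug_ideal Adeg (F i)) -> aug_ideal Adeg (\sum_(i <- r) F i).
Proof.
move=> Fa; elim: r => [|i r IH]; first by rewrite big_nil; apply: aug_ideal0.
by rewrite big_cons; apply: aug_idealD.
Qed.

Lemma aug_ideal_homog (j : int) a : 0 < j -> Adeg j a -> aug_ideal Adeg a.
Proof.
case: j => [j|//]; rewrite ltz_nat => j0 aj.
exists j.+1, (fun l => if l == j%:Z then a else 0); split=> [l|].
  by case: eqP => [->|_] //; apply: gdeg0 Agr _.
rewrite big_nat_recr //= eqxx big_nat big1 ?add0r // => l /andP[_ lj].
by rewrite eqz_nat (ltn_eqF lj).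
Qed.

Lemma aug_subD (V : gmod) (v w : V) :
  aug_sub Adeg v -> aug_sub Adeg w -> aug_sub Adeg (v + w).
Proof.
move=> [s sP ->] [t tP ->]; exists (s ++ t); last by rewrite big_cat.
by move=> x; rewrite mem_cat => /orP[/sP|/tP].
Qed.

Lemma aug_subZ (V : gmod) a (v : V) : aug_ideal Adeg a -> aug_sub Adeg (a *: v).
Proof.
move=> aP; exists [:: (a, v)]; last by rewrite big_seq1.
by move=> x; rewrite inE => /eqP->.
Qed.

Lemma aug_sub_sum (V : gmod) I (r : seq I) (F : I -> V) :
  (forall i, aug_sub Adeg (F i)) -> aug_sub Adeg (\sum_(i <- r) F i).
Proof.
move=> Fa; elim: r => [|i r IH]; last by rewrite big_cons; apply: aug_subD.
by exists [::]; rewrite ?big_nil.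
Qed.

Lemma aug_sub_linear (V W : gmod) (f : V -> W) v :
  linear f -> aug_sub Adeg v -> aug_sub Adeg (f v).
Proof.
move=> fL [s sP ->]; exists [seq (t.1, f t.2) | t <- s].
  by move=> _ /mapP[t ts ->] /=; apply: sP.
rewrite (linear_fun_sum fL) big_map; apply: eq_bigr => t _.
by rewrite (linear_funZ fL).
Qed.

Lemma aug_subN (V : gmod) (v : V) : aug_sub Adeg v -> aug_sub Adeg (- v).
Proof.
apply: (aug_sub_linear (f := fun v => - v)) => c x y.
by rewrite opprD scalerN.
Qed.

Lemma aug_subB (V : gmod) (v w : V) :
  aug_sub Adeg v -> aug_sub Adeg w -> aug_sub Adeg (v - w).
Proof. by move=> vP wP; apply: aug_subD => //; apply: aug_subN. Qed.

End AugmentationIdeal.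

End GradedHomological.

(** * Tor does not depend on the resolution *)

Section TorIndependence.
Variables (k : fieldType) (B : algType k) (Bdeg : int -> B -> Prop).
Let Bcdeg : int -> B^c -> Prop := Bdeg.
Hypothesis Bgr : is_graded Bcdeg (regular_gmod Bcdeg).

(** Let [f : K -> F] and [g : F -> K] be comparison maps. On [K], minimality
    makes both terms of the homotopy from [g f] to the identity fall into the
    augmentation submodule, so [g f] is the identity modulo it. On a cycle [z]
    of [F] (x) k, the term [h (d z)] of the homotopy from [f g] to the
    identity does, so [z] and [f (g z)] differ by a boundary. Hence [f]
    carries a basis of the fibre of [K] to a basis of the homology of [F] (x)
    k. *)
Lemma tor_dim_from_minimal (M : gmod B^c) (F K : nat -> gmod B^c)
    (d : forall i, F i.+1 -> F i) (eps : F 0%N -> M)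
    (dK : forall i, K i.+1 -> K i) (epsK : K 0%N -> M) i j n :
  graded_free_resolution Bcdeg d eps ->
  minimal_graded_free_resolution Bcdeg dK epsK ->
  quot_dim (fun x : K i => gdeg j x) (aug_sub Bcdeg (V := K i)) n ->
  tor_dim Bdeg d i j n.
Proof.
move=> rF [rK minK] [e [edeg ebasis]].
have [f [f0 fh fE]] := comparison Bgr rK rF.
have [g [g0 gh gE]] := comparison Bgr rF rK.
have homotopy_to_id (G : nat -> gmod B^c) dG epsG
    (u : forall i, aug_mod M G i -> aug_mod M G i) :
    graded_free_resolution Bcdeg (M := M) dG epsG ->
    u 0%N = idfun -> (forall i, graded_hom (u i)) ->
    (forall i x, aug_d dG epsG (u i.+1 x) = u i (aug_d dG epsG x)) ->
    exists h : forall i, aug_mod M G i -> aug_mod M G i.+1,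
    [/\ h 0%N = (fun=> 0), forall i, graded_hom (h i)
      & forall i x,
          x - u i.+1 x = aug_d dG epsG (h i.+1 x) + h i (aug_d dG epsG x)].
  move=> rG u0 uh ud.
  apply: (null_homotopy Bgr (chi := fun i x => x - u i x) rG) => [l|l x|x].
  - exact: graded_hom_sub (aug_mod_graded rG l) (graded_hom_id _) (uh l).
  - by rewrite (linear_funB (proj1 (aug_d_hom rG l))) ud.
  - by rewrite u0 subrr.
have [hF [hF0 hFh hFE]] := homotopy_to_id _ _ _ (fun l => f l \o g l) rF
  (etrans (congr1 (fun u => u \o g 0%N) f0) g0)
  (fun l => graded_hom_comp (fh l) (gh l))
  (fun l x => etrans (fE l _) (congr1 (f l) (gE l x))).
have [hK [hK0 hKh hKE]] := homotopy_to_id _ _ _ (fun l => g l \o f l) rK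
  (etrans (congr1 (fun u => u \o f 0%N) g0) f0)
  (fun l => graded_hom_comp (gh l) (fh l))
  (fun l x => etrans (gE l _) (congr1 (g l) (fE l x))).
have fL l := proj1 (fh l); have gL l := proj1 (gh l).
have aug0 (V : gmod B^c) : aug_sub Bcdeg (0 : V).
  by exists [::]; rewrite ?big_nil.
(* In homological degree 0, where every element is a cycle, the homotopy
   starts at the zero map on the module. *)
have cycle_h (G : nat -> gmod B^c) dG epsG
    (h : forall i, aug_mod M G i -> aug_mod M G i.+1) (x : G i) :
    h 0%N = (fun=> 0) -> (forall i, graded_hom (h i)) ->
    tor_cycle Bdeg dG x -> aug_sub Bcdeg (h i (aug_d dG epsG x)).
  move=> h0 hh; case: i x {edeg ebasis e} => [|i] x xcyc; first by rewrite h0.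
  exact: aug_sub_linear (proj1 (hh i.+1)) xcyc.
have gf_id (x : K i) : aug_sub Bcdeg (x - g i.+1 (f i.+1 x)).
  rewrite -[_ - _]/(x - (g i.+1 \o f i.+1) x) hKE.
  apply: aug_subD; first exact: minK.
  apply: cycle_h => //; case: i x {edeg ebasis e} => [|i] x //=.
exists (fun l => f i.+1 (e l)); split=> [l|z [zj zcyc]].
  split; first exact: (proj2 (fh i.+1)).
  case: i e edeg {ebasis cycle_h gf_id} => [|i] e edeg //=.
  rewrite -[d _ _]/(aug_d d eps (i := i.+1) _) fE.
  by apply: (aug_sub_linear (fL i.+1)); apply: minK.
have [c [cP cU]] := ebasis _ (proj2 (gh i.+1) _ _ zj).
exists c; split=> [|c' [y yj yP]].
  exists (hF i.+1 z); first exact: (proj2 (hFh i.+1)).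
  have fsum : f i.+1 (\sum_l (((c l)%:A : B) : B^c) *: e l) =
              \sum_l (((c l)%:A : B) : B^c) *: f i.+1 (e l).
    by rewrite (linear_fun_sum (fL _)); apply: eq_bigr => l _; rewrite (linear_funZ (fL _)).
  have -> : z - \sum_l (((c l)%:A : B) : B^c) *: f i.+1 (e l) - d i (hF i.+1 z) =
     hF i (aug_d d eps z) +
     f i.+1 (g i.+1 z - \sum_l (((c l)%:A : B) : B^c) *: e l).
    rewrite (linear_funB (fL _)) fsum.
    have /eqP := hFE i z; rewrite subr_eq => /eqP /=.
    move: (d i _) (hF i _) (f _ (g _ _)) (\sum_l _) => p q r s ->.
    by rewrite -(addrA p) [p + _]addrC [LHS]addrAC addrK addrA.
  apply: aug_subD; first exact: cycle_h.
  by apply: (aug_sub_linear (fL i.+1)); apply: cP.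
apply: cU.
set S' := \sum_l _ in yP.
pose S := \sum_l (((c' l)%:A : B) : B^c) *: e l.
have S'E : S' = f i.+1 S.
  by rewrite (linear_fun_sum (fL _)); apply: eq_bigr => l _; rewrite (linear_funZ (fL _)).
have gyP := aug_sub_linear (gL i.+1) yP.
have -> : g i.+1 z - S =
   g i.+1 (z - S' - d i y) + dK i (g i.+2 y) - (S - g i.+1 (f i.+1 S)).
  have -> : dK i (g i.+2 y) = g i.+1 (d i y) by apply: (gE i.+1).
  by rewrite !(linear_funB (gL _)) S'E subrK opprB addrA subrK.
apply: aug_subB => //; apply: aug_subD => //.
Qed.

End TorIndependence.

(** * Graded modules built from others *)

Section Constructions.
Variables (A : nzRingType) (Adeg : int -> A -> Prop).
Local Notation gmod := (gmod A).
Local Notation is_graded := (is_graded Adeg).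

Lemma shift_graded (V : gmod) m : is_graded V -> is_graded (shift V m).
Proof.
move=> Vgr; split=> [j|j v w|i j a v ai vj|v|s f us fd fs j js].
- exact: gdeg0 Vgr _.
- by move=> vj wj; exact: (gdegB Vgr vj wj).
- by rewrite /= -addrA; apply: (gdegZ Vgr).
- have [s [f [fd ->]]] := gdeg_span Vgr v.
  exists [seq l + m | l <- s], (fun l => f (l - m)); split=> [l|]; first exact: fd.
  by rewrite big_map; apply: eq_bigr => l _; rewrite addrK.
have := gdeg_direct Vgr (s := [seq l - m | l <- s]) (f := fun l => f (l + m)).
move/(_ _ _ _ (j - m)); rewrite subrK; apply.
- by rewrite map_inj_uniq //; apply: addIr.
- by move=> l; have := fd (l + m); rewrite /= addrK.
- by rewrite big_map -[RHS]fs; apply: eq_bigr => l _; rewrite subrK.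
- exact: map_f.
Qed.

Lemma gsum_graded (V W : gmod) : is_graded V -> is_graded W -> is_graded (gsum V W).
Proof.
move=> Vgr Wgr.
split=> [j|j v w [v1 v2] [w1 w2]|i j a v ai [v1 v2]|[v w]|s f us fd fs j js].
- by split; [apply: gdeg0 Vgr _|apply: gdeg0 Wgr _].
- by split; [apply: (gdegB Vgr)|apply: (gdegB Wgr)].
- by split; [apply: (gdegZ Vgr)|apply: (gdegZ Wgr)].
- have [s [f [fd ->]]] := gdeg_span Vgr v; have [t [g [gd ->]]] := gdeg_span Wgr w.
  have [f' [f'd [s' [us' f'0 ->]]]] := decomposes_exists Vgr (\sum_(j <- s) f j).
  have [g' [g'd [t' [ut' g'0 ->]]]] := decomposes_exists Wgr (\sum_(j <- t) g j).
  exists (undup (s' ++ t')), (fun j => (f' j, g' j)); split=> //.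
  rewrite -(sum_supported (t := undup (s' ++ t')) us' _ f'0) ?undup_uniq //; last first.
    by move=> j js; rewrite mem_undup mem_cat js.
  rewrite -(sum_supported (t := undup (s' ++ t')) ut' _ g'0) ?undup_uniq //; last first.
    by move=> j js; rewrite mem_undup mem_cat js orbT.
  by elim: (undup _) => [|l r IH]; rewrite ?big_nil // !big_cons -IH.
have fs1 : \sum_(j <- s) (f j).1 = 0 by rewrite -(raddf_sum fst) fs.
have fs2 : \sum_(j <- s) (f j).2 = 0 by rewrite -(raddf_sum snd) fs.
rewrite [f j]surjective_pairing.
rewrite (gdeg_direct Vgr us (fun j => proj1 (fd j)) fs1 js).
by rewrite (gdeg_direct Wgr us (fun j => proj2 (fd j)) fs2 js).
Qed.

Lemma gzero_graded : is_graded (gzero A).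
Proof.
split=> // [v|s f _ _ _ j _]; last by rewrite thinmx0.
by exists [::], (fun=> 0); split=> //; rewrite thinmx0 big_nil.
Qed.

(** The submodule is the image of a graded map, hence contains the homogeneous
    components of its elements; so a relation between homogeneous classes
    holds degree by degree. *)
Lemma gquot_graded (V W : gmod) (d : W -> V) (U : submodClosed V) :
  is_graded V -> is_graded W -> graded_hom d ->
  (forall v, v \in U <-> exists w, d w = v) -> is_graded (gquot U).
Proof.
move=> Vgr Wgr dh UE; split=> [j|j v w|i j a v ai|v|s f us fd fs j js].
- by exists 0; [apply: gdeg0 Vgr _|rewrite /qmod_pi raddf0].
- move=> [v' vj ->] [w' wj ->]; exists (v' - w'); first exact: (gdegB Vgr).
  by rewrite /qmod_pi raddfB.
- by move=> [v' vj ->]; exists (a *: v'); [apply: (gdegZ Vgr)|apply: qmod_piZ].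
- have [s [f [fd vE]]] := gdeg_span Vgr (repr v).
  exists s, (fun j => qmod_pi U (f j)); split=> [j|]; first by exists (f j).
  by rewrite -[LHS]qmod_reprK vE /qmod_pi raddf_sum.
have /choice[g gP] : forall j, exists v, gdeg j v /\ f j = qmod_pi U v.
  by move=> l; have [v vl fv] := fd l; exists v.
have [w wE] : exists w, d w = \sum_(l <- s) g l.
  apply/UE; rewrite -[X in X \in _]subr0 -qmod_piE; apply/eqP.
  rewrite /qmod_pi raddf_sum raddf0 -[RHS]fs; apply: eq_bigr => l _.
  by rewrite (proj2 (gP l)).
have gE : g j = d (hcomp Wgr j w).
  rewrite (hcomp_hom Wgr Vgr) // wE hcomp_bigsum (bigD1_seq j) //=.
  rewrite (hcomp_id Vgr (proj1 (gP j))) big1 ?addr0 // => l lj.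
  by rewrite (hcomp_homog Vgr _ (proj1 (gP l))) (negbTE lj).
rewrite (proj2 (gP j)); have -> : 0 = qmod_pi U 0 by rewrite /qmod_pi raddf0.
by apply/eqP; rewrite qmod_piE subr0; apply/UE; exists (hcomp Wgr j w).
Qed.

Hypothesis Agr : is_graded (regular_gmod Adeg).
Hypothesis Aneg : forall j a, j < 0 -> Adeg j a -> a = 0.


(** In a nonnegatively graded ring the elements of positive degree absorb
    multiplication; negative degrees are zero by hypothesis. *)
Lemma aug_idealMr a b : aug_ideal Adeg a -> aug_ideal Adeg (a * b).
Proof.
move=> [n [f [fd ->]]]; have [s ->] := hcomp_sum Agr b.
rewrite big_nat mulr_suml.
apply: (big_ind (aug_ideal Adeg)) => [||i /andP[i1 _]].
- exact: aug_ideal0.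
- exact: aug_idealD.
rewrite mulr_sumr; apply: aug_ideal_sum => // l.
have [l0|l0] := ltP l 0.
  by rewrite (Aneg l0 (hcomp_deg Agr l b)) mulr0; apply: aug_ideal0.
apply: (aug_ideal_homog Agr (j := i%:Z + l)); first by lia.
exact: (gdegZ Agr (fd _) (hcomp_deg Agr l b)).
Qed.

Lemma aug_idealMl u a (j : int) : 0 < j -> Adeg j a -> aug_ideal Adeg (u * a).
Proof.
move=> j0 aj; have [s ->] := hcomp_sum Agr u.
rewrite mulr_suml; apply: aug_ideal_sum => // l.
have [l0|l0] := ltP l 0.
  by rewrite (Aneg l0 (hcomp_deg Agr l u)) mul0r; apply: aug_ideal0.
apply: (aug_ideal_homog Agr (j := l + j)); first by lia.
exact: (gdegZ Agr (hcomp_deg Agr l u) aj).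
Qed.

Lemma aug_ideal_degree0 a : aug_ideal Adeg a -> hcomp Agr 0 a = 0.
Proof.
move=> [n [f [fd ->]]]; rewrite hcomp_bigsum big_nat big1 // => i /andP[i1 _].
by rewrite (hcomp_homog Agr _ (fd _)) eqz_nat -[i == 0]/(i == 0%N) gtn_eqF.
Qed.

Lemma free_coord_aug_sub (P : gmod) n (e : 'I_n -> P)
    (efree : forall v : P, exists! a : {ffun 'I_n -> A}, v = \sum_i a i *: e i)
    v i : aug_sub Adeg v -> aug_ideal Adeg (free_coord efree v i).
Proof.
move=> [s sP ->]; rewrite (linear_fun_sum (free_coord_linear efree i)) big_seq.
apply: (big_ind (aug_ideal Adeg)) => [||t ts].
- exact: aug_ideal0.
- exact: aug_idealD.
by rewrite (linear_funZ (free_coord_linear efree i)); apply: aug_idealMr; apply: sP.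
Qed.

End Constructions.

(** Modulo the augmentation submodule, a homogeneous element is determined by
    the degree-zero parts of its coordinates, which are scalars. When all
    generators have degree [m], such parts can occur only for [j = m]. *)
Lemma quot_dim_free (k : fieldType) (B : algType k) (Bdeg : int -> B -> Prop)
    (Bcdeg : int -> B^c -> Prop := Bdeg) (V : gmod B^c) m n (e : 'I_n -> V) j :
  is_graded Bcdeg (regular_gmod Bcdeg) ->
  (forall i b, i < 0 -> Bdeg i b -> b = 0) ->
  (forall b, Bdeg 0 b <-> exists c : k, b = c%:A) ->
  is_graded Bcdeg V -> (forall i, gdeg m (e i)) ->
  (forall v : V, exists! a : {ffun 'I_n -> B^c}, v = \sum_i a i *: e i) ->
  quot_dim (fun x : V => gdeg j x) (aug_sub Bcdeg (V := V))
    (if j == m then n else 0%N).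
Proof.
move=> Bgr Bneg B0 Vgr edeg efree.
have cdeg v i := free_coord_deg Bgr (deg := fun=> m) edeg efree Vgr (v := v) i (j := j).
case: eqP => [jm|/eqP jm]; last first.
  exists (fun=> 0); split=> [[]//|v vj].
  exists [ffun=> 0]; split=> [|c _]; last by apply/ffunP => -[].
  rewrite big_ord0 subr0 (free_coordE efree v).
  apply: aug_sub_sum => i; apply: aug_subZ.
  have vi := cdeg v i vj.
  have [j0|j0|/eqP j0] := ltgtP (j - m) 0; last by rewrite subr_eq0 (negbTE jm) in j0.
    by rewrite (Bneg _ _ j0 vi); apply: aug_ideal0 Bgr.
  exact: (aug_ideal_homog Bgr j0 vi).
exists e; split=> [l|v vj]; first by rewrite jm; apply: edeg.
have /choice[c cP] : forall i, exists c : k, free_coord efree v i = (c%:A : B).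
  by move=> i; apply/B0; have := cdeg v i vj; rewrite jm subrr.
have vE : v = \sum_i (((c i)%:A : B) : B^c) *: e i.
  by rewrite {1}(free_coordE efree v); apply: eq_bigr => i _; rewrite cP.
exists (finfun c); split=> [|c' c'P].
  under eq_bigr do rewrite ffunE.
  by rewrite -vE subrr; exists [::]; rewrite ?big_nil.
apply/ffunP => i; rewrite ffunE.
have := free_coord_aug_sub Bgr Bneg efree i c'P.
rewrite (free_coord_uniq efree (a := fun i => (((c i)%:A - (c' i)%:A : B) : B^c))); last first.
  rewrite vE -sumrB; apply: eq_bigr => l _.
  by rewrite -scalerBl.
move/(aug_ideal_degree0 Bgr); rewrite (hcomp_id Bgr); last first.
  by apply/B0; exists (c i - c' i); rewrite scalerBl.
by move/eqP; rewrite subr_eq0 => /eqP /(fmorph_inj (in_alg B)).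
Qed.

(** * The Koszul-type complex of two anticommuting elements *)

Section Koszul.
Variables (A : nzRingType) (Adeg : int -> A -> Prop) (a b : A).
Hypothesis Agr : is_graded Adeg (regular_gmod Adeg).
Hypothesis Aneg : forall j x, j < 0 -> Adeg j x -> x = 0.
Hypothesis A1 : Adeg 0 1.
Hypotheses (adeg : Adeg 1 a) (bdeg : Adeg 1 b).
Hypothesis abC : b * a + a * b = 0.
Hypothesis areg : forall w, w * a = 0 -> w = 0.
Hypothesis ab_exact : forall u v, u * a + v * b = 0 ->
  exists w, u = w * b /\ v = w * a.

Lemma koszul_graded i : is_graded Adeg (koszul_mod Adeg i).
Proof.
have sgr := shift_graded _ Agr.
by case: i => [|[|[|i]]]; [exact: Agr|exact: gsum_graded|exact: sgr|exact: gzero_graded].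
Qed.

(** The generators of the [i]-th term all lie in degree [i]; this is why each
    term contributes to a single internal degree. *)
Lemma koszul_basis i :
  let n := match i with 0 => 1%N | 1 => 2%N | 2 => 1%N | _ => 0%N end in
  exists e : 'I_n -> koszul_mod Adeg i, (forall l, gdeg i%:Z (e l)) /\
  forall v : koszul_mod Adeg i,
    exists! c : {ffun 'I_n -> A}, v = \sum_l c l *: e l.
Proof.
have rank1 : forall v : A^o,
    exists! c : {ffun 'I_1 -> A}, v = \sum_l c l *: (1 : A^o).
  move=> v; exists [ffun=> v]; split=> [|c ->].
    by rewrite big_ord1 ffunE [RHS]mulr1.
  by apply/ffunP => l; rewrite ffunE big_ord1 [l]ord1 [LHS]mulr1.
case: i => [|[|[|i]]] /=.
- by exists (fun=> 1).
- exists (fun l => if l == 0 then (1, 0) else (0, 1)); split=> [l|[u v]].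
    by case: eqP => _ /=; rewrite subrr; split=> //; apply: gdeg0 Agr _.
  exists [ffun l => if l == 0 then u else v]; split=> [|c].
    rewrite big_ord_recl big_ord1 !ffunE /=; congr (_, _).
      by rewrite /= [X in X + _]mulr1 [X in _ + X]mulr0 addr0.
    by rewrite /= [X in X + _]mulr0 [X in _ + X]mulr1 add0r.
  rewrite big_ord_recl big_ord1 => -[].
  rewrite [X in X + _]mulr1 [X in _ + X]mulr0 addr0 => ->.
  rewrite [X in X + _]mulr0 [X in _ + X]mulr1 add0r => ->.
  apply/ffunP => l; rewrite ffunE; case: eqP => [->//|].
  by case: l => -[|[|//]] lP l0; [case: l0|congr (c _)]; apply/val_inj.
- by exists (fun=> 1); split=> // l; rewrite subrr.
exists (fun=> 0); split=> // v; exists [ffun=> 0].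
by split=> [|c _]; [rewrite [LHS]thinmx0 [RHS]thinmx0|apply/ffunP => -[]].
Qed.

(** Written for left modules over [A]; over the opposite ring of an algebra it
    gives the resolution of a right module. Exactness in the middle and on the
    left is exactly [ab_exact] and [areg]; the differentials have entries of
    degree one, so the complex is minimal. *)
Lemma koszul_resolution :
  minimal_graded_free_resolution Adeg (M := quot2 Adeg a b) (F := koszul_mod Adeg)
    (koszul_d Adeg (fun p : A * A => p.1 * a + p.2 * b)
       (fun w : A => (w * b, w * a)))
    (quot2_pi Adeg a b).
Proof.
have d1h : @graded_hom A (koszul_mod Adeg 1) (koszul_mod Adeg 0)
    (fun p : A * A => p.1 * a + p.2 * b).
  split=> [c [u v] [u' v']|j [u v] [/= uj vj]] /=.
    rewrite !mulrDl -!mulrA addrACA; congr (_ + _).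
    exact: (esym (mulrDr _ _ _)).
  rewrite -[j](subrK 1); apply: (gdegD Agr).
    exact: (gdegZ Agr uj adeg).
  exact: (gdegZ Agr vj bdeg).
have idealE v : v \in ideal2_submodule a b <->
    exists w : koszul_mod Adeg 1, w.1 * a + w.2 * b = v.
  split=> [/asboolP[u [v' ->]]|[[u v'] <-]]; first by exists (u, v').
  by apply/asboolP; exists u, v'.
split; first split.
- exact: gquot_graded Agr (koszul_graded 1) d1h idealE.
- exact: koszul_graded.
- move=> i; have [e [ed eb]] := koszul_basis i.
  by exists _, (fun=> i%:Z), e.
- case=> [|[|i]] //=.
  + split=> [c u v|j w /= wj].
      congr (_, _); rewrite mulrDl; congr (_ + _);
        exact: (esym (mulrA _ _ _)).
    have -> : j - 1 = j - 2 + 1 by rewrite -addrA.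
    by split; [exact: (gdegZ Agr wj bdeg)|exact: (gdegZ Agr wj adeg)].
  + split=> [c u v|j w /= _]; first by rewrite scaler0 addr0.
    exact: (gdeg0 (koszul_graded i.+2)).
- split=> [c u v|j v vj]; last by exists v.
  by rewrite /quot2_pi qmod_piD -qmod_piZ.
- by move=> m; exists (repr m); apply: qmod_reprK.
- move=> v; apply: (iff_trans _ (idealE v)).
  have -> : 0 = quot2_pi Adeg a b 0 by rewrite /quot2_pi /qmod_pi raddf0.
  rewrite -[X in X \in _](subr0 v) -qmod_piE.
  by split=> [vE|/eqP vE]; [apply/eqP|]; exact: vE.
- case=> [|[|i]] x /=.
  + case: x => u v /=; split=> [/ab_exact[w [-> ->]]|[w [<- <-]]]; first by exists w.
    by rewrite -!mulrA -mulrDr abC mulr0.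
  + split=> [[_ /areg->]|[_ <-]]; first by exists 0.
    by rewrite !mul0r.
  + split=> _ //; exists 0; by rewrite [LHS]thinmx0 [RHS]thinmx0.
have aug_a (u : A) : aug_ideal Adeg (u * a) by apply: aug_idealMl adeg.
have aug_b (u : A) : aug_ideal Adeg (u * b) by apply: aug_idealMl bdeg.
case=> [|[|i]] x /=.
- have -> : x.1 * a + x.2 * b = (x.1 * a + x.2 * b) *: (1 : A^o).
    by rewrite [RHS]mulr1.
  by apply: aug_subZ; apply: aug_idealD.
- have -> : (x * b, x * a) =
      (x * b) *: (1, 0) + (x * a) *: (0, 1) :> (A^o * A^o)%type.
    congr (_, _); first by rewrite /= [X in X + _]mulr1 [X in _ + X]mulr0 addr0.
    by rewrite /= [X in X + _]mulr0 [X in _ + X]mulr1 add0r.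
  by apply: (@aug_subD _ _ (koszul_mod Adeg 1)); apply: aug_subZ.
- by exists [::]; rewrite ?big_nil.
Qed.

End Koszul.

(** * Monomial operators on a space with a basis *)

Lemma malg_ind (k : fieldType) (T : choiceType) (P : {malg k[T]} -> Prop) :
  P 0 -> (forall f g, P f -> P g -> P (f + g)) ->
  (forall c t, P << c *g t >>) -> forall f, P f.
Proof.
by move=> P0 PD PU f; rewrite [f]monalgE; apply: big_ind.
Qed.

Lemma malgUZ (k : fieldType) (T : choiceType) (c : k) (t : T) :
  << c *g t >> = c *: << t >> :> {malg k[T]}.
Proof. by apply/malgP => t'; rewrite mcoeffZ !mcoeffU mulrnAr mulr1. Qed.

Section LinearExtension.
Variables (k : fieldType) (T : choiceType) (W : lmodType k) (h : T -> W).

(** The linear extension of a function on the basis. It serves both for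
    operators on the space of normal forms and for the action of the free
    algebra, whose basis is the set of words. *)
Definition lext (v : {malg k[T]}) : W := \sum_(t <- msupp v) v@_t *: h t.

Lemma lextEw (d : {fset T}) v : (msupp v `<=` d)%fset ->
  lext v = \sum_(t <- d) v@_t *: h t.
Proof.
move=> vd; rewrite [LHS](big_fset_incl _ vd) //= => t _ /mcoeff_outdom ->.
by rewrite scale0r.
Qed.

Lemma lext_linear : linear lext.
Proof.
move=> c v w; set d := (msupp v `|` msupp w)%fset.
rewrite (lextEw (d := d)); last first.
  apply: fsubset_trans (msuppD_le _ _) _; apply: fsetSU; exact: msuppZ_le.
rewrite (@lextEw d v) ?fsubsetUl // (@lextEw d w) ?fsubsetUr //.
rewrite scaler_sumr -big_split; apply: eq_bigr => t _ /=.
by rewrite mcoeffD mcoeffZ scalerDl scalerA.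
Qed.

HB.instance Definition _ := GRing.isLinear.Build k {malg k[T]} W _ lext lext_linear.

Lemma lextU c t : lext << c *g t >> = c *: h t.
Proof. by rewrite (lextEw msuppU_le) big_seq_fset1 mcoeffUU. Qed.

End LinearExtension.

Section MonomialOperators.
Variables (k : fieldType) (T : choiceType).
Local Notation V := {malg k[T]}.

(** Operators sending each basis vector to a multiple of a basis vector;
    identities between their composites are checked on exponents and
    coefficients. *)
Definition mop (c : T -> k) (s : T -> T) : V -> V :=
  lext (fun t => << c t *g s t >>).
HB.instance Definition _ c s := GRing.Linear.on (mop c s).

Lemma mopU c s (x : k) t : mop c s << x *g t >> = << x * c t *g s t >>.
Proof.
rewrite [LHS]lextU; apply/malgP => t'.
by rewrite mcoeffZ !mcoeffU mulrnAr.
Qed.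

Lemma mopU1 c s t : mop c s << t >> = << c t *g s t >>.
Proof. by rewrite [LHS]mopU mul1r. Qed.

Lemma mop_comp_eq (x : k) c s c' s' e f e' f' :
  (forall t, s (s' t) = f (f' t)) ->
  (forall t, c' t * c (s' t) = x * (e' t * e (f' t))) ->
  forall v, mop c s (mop c' s' v) = x *: mop e f (mop e' f' v).
Proof.
move=> sf ce; elim/malg_ind => [|v w IHv IHw|y t].
- by rewrite !linear0.
- by rewrite !linearD /= IHv IHw.
rewrite !mopU sf -!mulrA ce; apply/malgP => t'.
rewrite mcoeffZ !mcoeffU mulrnAr; congr (_ *+ _).
by rewrite mulrCA.
Qed.

Lemma mop_coef c s v t : injective s -> (mop c s v)@_(s t) = v@_t * c t.
Proof.
move=> sI; elim/malg_ind: v => [|v w IHv IHw|y t'].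
- by rewrite linear0 !mcoeff0 mul0r.
- by rewrite linearD /= !mcoeffD IHv IHw mulrDl.
rewrite mopU !mcoeffU (inj_eq sI) mulrnAl.
by case: eqP => [->|] //; rewrite !mulr0n.
Qed.

Lemma mop_coef_out c s v t : (forall t', s t' != t) -> (mop c s v)@_t = 0.
Proof.
move=> sN; elim/malg_ind: v => [|v w IHv IHw|y t'].
- by rewrite linear0 !mcoeff0.
- by rewrite linearD /= !mcoeffD IHv IHw addr0.
by rewrite mopU !mcoeffU (negbTE (sN _)).
Qed.

Lemma mop_inj c s v : injective s -> (forall t, c t != 0) -> mop c s v = 0 -> v = 0.
Proof.
move=> sI c0 v0; apply/malgP => t; have := mop_coef c v t sI.
by rewrite v0 !mcoeff0 => /esym/eqP; rewrite mulf_eq0 (negbTE (c0 t)) orbF => /eqP.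
Qed.

(** Koszul exactness for two anticommuting monomial operators [X1], [X2].
    Write [u = u0 + X2 w] where [u0] avoids the image [p] of [s2]. Then [X1 u0
    + X2 (v - X1 w) = 0], and the two terms have disjoint supports because
    [s1] preserves the complement of [p]; so both vanish, and injectivity
    concludes. *)
Lemma mop_exact c1 s1 c2 s2 (p : pred T) (r : T -> T) u v :
  injective s1 -> injective s2 -> (forall t, c1 t != 0) -> (forall t, c2 t != 0) ->
  (forall t, p (s2 t)) -> (forall t, p t -> s2 (r t) = t) ->
  (forall t, p (s1 t) = p t) ->
  (forall w, mop c1 s1 (mop c2 s2 w) = - mop c2 s2 (mop c1 s1 w)) ->
  mop c1 s1 u + mop c2 s2 v = 0 ->
  exists w, u = mop c2 s2 w /\ v = mop c1 s1 w.
Proof.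
move=> s1I s2I c1N c2N ps2 rK ps1 anti.
have [w [u0 [u0s ->]]] : exists w u0,
    (forall t, p t -> u0@_t = 0) /\ u = u0 + mop c2 s2 w.
  elim/malg_ind: u => [|u u' [w [u0 [u0p ->]]] [w' [u0' [u0p' ->]]]|y t].
  - by exists 0, 0; split=> [t|]; rewrite ?mcoeff0 // linear0 addr0.
  - exists (w + w'), (u0 + u0'); split=> [t pt|]; last by rewrite linearD addrACA.
    by rewrite mcoeffD u0p ?u0p' ?addr0.
  have [pt|pt] := boolP (p t).
    exists << y / c2 (r t) *g r t >>, 0; split=> [t' _|]; first by rewrite mcoeff0.
    by rewrite mopU divfK // rK // add0r.
  exists 0, << y *g t >>; split=> [t' pt'|]; last by rewrite linear0 addr0.
  by rewrite mcoeffU; case: eqP pt' pt => // -> ->.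
rewrite linearD /= anti -addrA [- _ + _]addrC -linearB /= => eq0.
have u00 : u0 = 0.
  apply/malgP => t; rewrite mcoeff0; have [/u0s //|pt] := boolP (p t).
  have /(congr1 (mcoeff (s1 t))) := eq0.
  rewrite mcoeff0 mcoeffD mop_coef // mop_coef_out ?addr0; last first.
    by move=> t'; apply: contraNneq pt => /(congr1 p); rewrite ps2 ps1.
  by move/eqP; rewrite mulf_eq0 (negbTE (c1N t)) orbF => /eqP.
exists w; split; first by rewrite u00 add0r.
move: eq0; rewrite u00 linear0 add0r => /(mop_inj s2I c2N).
by move/eqP; rewrite subr_eq0 => /eqP.
Qed.

End MonomialOperators.

(** * The presented algebra and its modules *)

Lemma ord4_ind (P : 'I_4 -> Prop) :
  P (inord 0) -> P (inord 1) -> P (inord 2) -> P (inord 3) -> forall i, P i.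
Proof.
move=> P0 P1 P2 P3 i; rewrite -[i]inord_val.
by case: i => -[|[|[|[|//]]]].
Qed.

Section Presentation.
Variables (k : fieldType) (alpha : k).
Local Notation B := (BK alpha).
Local Notation gen := (@genBK k alpha).
Local Notation pi := (@BK_pi k alpha).
Local Notation free := {malg k[{fmonom 'I_4}]}.
Local Notation x1 := (BKx1 alpha).
Local Notation x2 := (BKx2 alpha).
Local Notation y1 := (BKy1 alpha).
Local Notation y2 := (BKy2 alpha).

Lemma pi_mul (f g : free) : pi (f * g) = pi f * pi g.
Proof. exact: (esym (BK_piM alpha f g)). Qed.

Lemma pi_scale c (f : free) : pi (c *: f) = c *: pi f.
Proof. exact: (esym (BK_piZ alpha c f)). Qed.

Lemma pi_word (w : seq 'I_4) : pi << FMonom w >> = \prod_(i <- w) gen i.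
Proof.
elim: w => [|i w IH]; first by rewrite big_nil -fmoneE.
rewrite big_cons -IH -pi_mul; congr pi.
rewrite malgM_def fgmulUU mulr1; congr (<< _ *g _ >>).
by apply/eqP; rewrite fmP fmM fmU.
Qed.

(** Words in the generators span the algebra, being the images of the basis of
    the free algebra. *)
Lemma BK_words (b : B) : exists s : seq (k * seq 'I_4),
  b = \sum_(t <- s) t.1 *: \prod_(i <- t.2) gen i.
Proof.
rewrite -[b]BK_reprK; elim/malg_ind: (repr b) => [|f g [s IHf] [t IHg]|c m].
- by exists [::]; rewrite big_nil /BK_pi raddf0.
- by exists (s ++ t); rewrite BK_piD big_cat IHf IHg.
exists [:: (c, fmonom_val m)]; rewrite big_seq1 -pi_word fmK -pi_scale.
exact: (congr1 pi (malgUZ c m)).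
Qed.

Lemma relBK r : r \in relsBK alpha -> pi r = 0.
Proof.
move=> rP; have -> : 0 = pi 0 by rewrite /BK_pi raddf0.
apply/eqP; rewrite BK_piE subr0; apply/asboolP; exists [:: (1, r, 1)].
  by move=> t; rewrite inE => /eqP->.
by rewrite big_seq1 /=; apply: (esym (etrans (mulr1 _) (mul1r _))).
Qed.

Lemma all6 (T : Type) (p : pred T) a b c d e f :
  all p [:: a; b; c; d; e; f] ->
  [/\ p a, p b & p c] /\ [/\ p d, p e & p f].
Proof. by move=> /= /and5P[? ? ? ? /and3P[? ? _]]. Qed.

Lemma all6I (T : Type) (p : pred T) a b c d e f :
  p a -> p b -> p c -> p d -> p e -> p f -> all p [:: a; b; c; d; e; f].
Proof. by move=> /= -> -> -> -> -> ->. Qed.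

Lemma pi_sub (f g : free) : pi (f - g) = pi f - pi g.
Proof. by rewrite /BK_pi raddfB. Qed.

Lemma pi_addM (f g f' g' : free) :
  pi (f * g + f' * g') = pi f * pi g + pi f' * pi g'.
Proof.
rewrite BK_piD.
exact: (f_equal2 (fun p q => p + q) (pi_mul f g) (pi_mul f' g')).
Qed.

Lemma pi_subM (f g f' g' : free) :
  pi (f * g - f' * g') = pi f * pi g - pi f' * pi g'.
Proof.
rewrite pi_sub.
exact: (f_equal2 (fun p q => p - q) (pi_mul f g) (pi_mul f' g')).
Qed.

Lemma pi_subZM c (f g f' g' : free) :
  pi (f * g - c *: (f' * g')) = pi f * pi g - c *: (pi f' * pi g').
Proof.
rewrite pi_sub (pi_scale c).
exact: (f_equal2 (fun p q => p - c *: q) (pi_mul f g) (pi_mul f' g')).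
Qed.

Lemma BK_relations :
  [/\ x2 * x1 = - (x1 * x2), y2 * y1 = - (y1 * y2) & y1 * x1 = x1 * y1] /\
  [/\ y1 * x2 = x2 * y2, y2 * x1 = x1 * y2 & y2 * x2 = alpha *: (x2 * y1)].
Proof.
have allr : all (fun r => pi r == 0) (relsBK alpha).
  by apply/allP => r rP; apply/eqP/relBK.
have [[/eqP r1 /eqP r2 /eqP r3] [/eqP r4 /eqP r5 /eqP r6]] := all6 allr.
split; split.
- by apply/eqP; rewrite -addr_eq0 -[X in X == 0](pi_addM (letter _ _)) r1.
- by apply/eqP; rewrite -addr_eq0 -[X in X == 0](pi_addM (letter _ _)) r2.
- by apply/eqP; rewrite -subr_eq0 -[X in X == 0](pi_subM (letter _ _)) r3.
- by apply/eqP; rewrite -subr_eq0 -[X in X == 0](pi_subM (letter _ _)) r4.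
- by apply/eqP; rewrite -subr_eq0 -[X in X == 0](pi_subM (letter _ _)) r5.
by apply/eqP; rewrite -subr_eq0 -[X in X == 0](pi_subZM _ (letter _ _)) r6.
Qed.

Section Modules.
Variables (V : lmodType k) (T : 'I_4 -> {linear V -> V}).
Hypothesis T10 : forall v, T (inord 1) (T (inord 0) v) = - T (inord 0) (T (inord 1) v).
Hypothesis T32 : forall v, T (inord 3) (T (inord 2) v) = - T (inord 2) (T (inord 3) v).
Hypothesis T20 : forall v, T (inord 2) (T (inord 0) v) = T (inord 0) (T (inord 2) v).
Hypothesis T21 : forall v, T (inord 2) (T (inord 1) v) = T (inord 1) (T (inord 3) v).
Hypothesis T30 : forall v, T (inord 3) (T (inord 0) v) = T (inord 0) (T (inord 3) v).
Hypothesis T31 : forall v,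
  T (inord 3) (T (inord 1) v) = alpha *: T (inord 1) (T (inord 2) v).

Definition word_act (w : seq 'I_4) (v : V) : V := foldr (fun i => T i) v w.

Lemma word_act_linear w : linear (word_act w).
Proof. by elim: w => [|i w IH] c u v //=; rewrite IH linearP. Qed.

Definition free_act (f : free) (v : V) : V :=
  lext (fun m : {fmonom 'I_4} => word_act (fmonom_val m) v) f.

Lemma free_actD f g v : free_act (f + g) v = free_act f v + free_act g v.
Proof. exact: linearD. Qed.

Lemma free_actB f g v : free_act (f - g) v = free_act f v - free_act g v.
Proof. exact: linearB. Qed.

Lemma free_actZ c f v : free_act (c *: f) v = c *: free_act f v.
Proof. exact: linearZ. Qed.

Lemma free_act0 v : free_act 0 v = 0.
Proof. exact: linear0. Qed.

Lemma free_act_linear f : linear (free_act f).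
Proof.
elim/malg_ind: f => [|f g IHf IHg|x m] c u v.
- by rewrite !free_act0 scaler0 addr0.
- by rewrite !free_actD IHf IHg scalerDr addrACA.
rewrite /free_act !lextU word_act_linear scalerDr !scalerA.
by rewrite [x * c]mulrC.
Qed.

Lemma free_actM f g v : free_act (f * g) v = free_act f (free_act g v).
Proof.
have actDl (p q r : free) :
    free_act ((p + q) * r) v = free_act (p * r) v + free_act (q * r) v.
  by rewrite mulrDl; apply: free_actD.
have actDr (p q r : free) :
    free_act (p * (q + r)) v = free_act (p * q) v + free_act (p * r) v.
  by rewrite mulrDr; apply: free_actD.
elim/malg_ind: f => [|f f' IHf IHf'|x m].
- by rewrite (mul0r g) !free_act0.
- rewrite actDl (free_actD f f' (free_act g v)).
  exact: (f_equal2 (fun p q => p + q) IHf IHf').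
elim/malg_ind: g => [|g g' IHg IHg'|y m'].
- by rewrite mulr0 free_act0 (linear_fun0 (free_act_linear _)).
- rewrite actDr (free_actD g g' v) (linear_funD (free_act_linear _)).
  exact: (f_equal2 (fun p q => p + q) IHg IHg').
rewrite malgM_def fgmulUU /free_act !lextU (linear_funZ (word_act_linear _)) scalerA.
by rewrite fmM /word_act foldr_cat.
Qed.

Lemma free_act_letter i v : free_act (letter k i) v = T i v.
Proof. by rewrite /free_act lextU scale1r fmuE. Qed.

(** The relations act by zero, and the action is multiplicative, so the
    two-sided ideal they generate acts by zero. *)
Lemma free_act_ideal f v : idealBK alpha f -> free_act f v = 0.
Proof.
have act2 i j u : free_act (letter k i * letter k j) u = T i (T j u).
  by rewrite (free_actM (letter k i) (letter k j) u) !free_act_letter.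
have actD i j i' j' u :
    free_act (letter k i * letter k j + letter k i' * letter k j') u =
    T i (T j u) + T i' (T j' u).
  by rewrite free_actD; congr (_ + _); apply: act2.
have actB i j i' j' u :
    free_act (letter k i * letter k j - letter k i' * letter k j') u =
    T i (T j u) - T i' (T j' u).
  by rewrite free_actB; congr (_ - _); apply: act2.
have actBZ c i j i' j' u :
    free_act (letter k i * letter k j - c *: (letter k i' * letter k j')) u =
    T i (T j u) - c *: T i' (T j' u).
  by rewrite free_actB free_actZ; congr (_ - _ *: _); apply: act2.
have relP r u : r \in relsBK alpha -> free_act r u = 0.
  move=> rP; apply/eqP.
  suff /allP/(_ r rP) : all (fun r => free_act r u == 0) (relsBK alpha) by [].
  apply: all6I.
  - by rewrite actD T10 addNr.
  - by rewrite actD T32 addNr.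
  - by rewrite actB T20 subrr.
  - by rewrite actB T21 subrr.
  - by rewrite actB T30 subrr.
  by rewrite actBZ T31 subrr.
move=> /asboolP[s sP ->].
rewrite (big_morph (free_act^~ v) (fun f g => free_actD f g v) (free_act0 v)).
rewrite big_seq big1 // => -[[p r] q] /sP /= rP.
rewrite (free_actM (p * r) q) (free_actM p r) (relP r _ rP).
exact: (linear_fun0 (free_act_linear _)).
Qed.

Definition BK_act (b : B) (v : V) : V := free_act (repr b) v.

Lemma BK_act_pi f v : BK_act (pi f) v = free_act f v.
Proof.
have := free_act_ideal v (BK_repr alpha f).
rewrite free_actB => /eqP.
by rewrite subr_eq0 => /eqP.
Qed.

Lemma BK_actD a b v : BK_act (a + b) v = BK_act a v + BK_act b v.
Proof.
by rewrite -[a]BK_reprK -[b]BK_reprK -BK_piD !BK_act_pi free_actD.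
Qed.

Lemma BK_actZ c b v : BK_act (c *: b) v = c *: BK_act b v.
Proof. by rewrite -[b]BK_reprK -pi_scale !BK_act_pi free_actZ. Qed.

Lemma BK_act_gen i b v : BK_act (gen i * b) v = T i (BK_act b v).
Proof.
by rewrite -[b]BK_reprK -pi_mul !BK_act_pi free_actM free_act_letter.
Qed.

(** The universal property used below: operators that satisfy the relations
    make [V] a module, and the orbit map of [v] intertwines multiplication by
    the generators with the operators. *)
Lemma orbit_map (v : V) : exists nf : {linear B -> V},
  nf 1 = v /\ forall i b, nf (gen i * b) = T i (nf b).
Proof.
have actL : linear (BK_act^~ v) by move=> c a b; rewrite BK_actD BK_actZ.
pose nf : {linear B -> V} :=
  HB.pack (BK_act^~ v) (GRing.isLinear.Build k B V *:%R (BK_act^~ v) actL).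
exists nf; split=> [|i b]; last exact: BK_act_gen.
have -> : nf 1 = BK_act (pi 1) v by [].
by rewrite BK_act_pi /free_act lextU scale1r fm1.
Qed.

End Modules.

End Presentation.

(** * The operators on normal monomials *)

(** The exponents (a, b, c, d) of the normal monomial x1^a x2^b y1^c y2^d. *)
Definition exponent := (nat * nat * nat * nat)%type.
HB.instance Definition _ := Choice.on exponent.

Definition expdeg (t : exponent) : nat :=
  let: (a, b, c, d) := t in (a + b + c + d)%N.

Lemma mop_deg (k : fieldType) c (s : exponent -> exponent)
    (v : {malg k[exponent]}) n :
  (forall t, expdeg (s t) = (expdeg t).+1) ->
  (forall t, expdeg t != n -> v@_t = 0) ->
  forall t, expdeg t != n.+1 -> (mop c s v)@_t = 0.
Proof.
move=> sdeg vn t tn; rewrite /mop /lext raddf_sum /= big1 // => t' _.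
rewrite mcoeffZ mcoeffU; case: eqP => [tE|_]; last by rewrite mulr0.
by rewrite vn ?mul0r // -eqSS -sdeg tE.
Qed.

Section Model.
Variables (k : fieldType) (alpha : k).
Local Notation V := {malg k[exponent]}.

(** Left multiplication by the generators on normal monomials. Moving y1 or y2
    across x2 exchanges the two, up to alpha, so the outcome depends on the
    parity of b. A factor alpha appears at each crossing by y2, hence at every
    second crossing: y1 starts with a free one, y2 with a charged one. *)
Definition lcoef (i : nat) (t : exponent) : k :=
  let: (a, b, c, d) := t in
  match i with
  | 0 => 1
  | 1 => (-1) ^+ a
  | 2 => if odd b then alpha ^+ b./2 * (-1) ^+ c else alpha ^+ b./2
  | _ => if odd b then alpha ^+ (b./2).+1 else alpha ^+ b./2 * (-1) ^+ c
  end.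

Definition lstep (i : nat) (t : exponent) : exponent :=
  let: (a, b, c, d) := t in
  match i with
  | 0 => (a.+1, b, c, d)
  | 1 => (a, b.+1, c, d)
  | 2 => if odd b then (a, b, c, d.+1) else (a, b, c.+1, d)
  | _ => if odd b then (a, b, c.+1, d) else (a, b, c, d.+1)
  end.

Definition lop (i : 'I_4) : V -> V := mop (lcoef i) (lstep i).
HB.instance Definition _ i := GRing.Linear.on (lop i).

Lemma lopE n : (n < 4)%N -> lop (inord n) = mop (lcoef n) (lstep n).
Proof.
by move=> n4; rewrite /lop; congr (mop (lcoef _) (lstep _)); apply: inordK.
Qed.

(** Right multiplication by x2 on normal monomials: y1^c y2^d x2 = alpha^d x2
    y2^c y1^d, and reordering the y's costs the sign (-1)^(c d). *)
Definition rcoef2 (t : exponent) : k :=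
  let: (a, b, c, d) := t in alpha ^+ d * (-1) ^+ (c * d).
Definition rstep2 (t : exponent) : exponent :=
  let: (a, b, c, d) := t in (a, b.+1, d, c).
Definition rcoef1 (t : exponent) : k := let: (a, b, c, d) := t in (-1) ^+ b.

Definition rop1 : V -> V := mop rcoef1 (lstep 0).
Definition rop2 : V -> V := mop rcoef2 rstep2.
HB.instance Definition _ := GRing.Linear.on rop1.
HB.instance Definition _ := GRing.Linear.on rop2.

Lemma lop_rel10 v :
  lop (inord 1) (lop (inord 0) v) = - lop (inord 0) (lop (inord 1) v).
Proof.
rewrite -scaleN1r; apply: mop_comp_eq; rewrite !inordK // => -[[[a b] c] d] //=.
by rewrite exprS; ring.
Qed.

Lemma lop_rel32 v :
  lop (inord 3) (lop (inord 2) v) = - lop (inord 2) (lop (inord 3) v).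
Proof.
rewrite -scaleN1r; apply: mop_comp_eq; rewrite !inordK // => -[[[a b] c] d] /=;
  case: (boolP (odd b)) => ob; rewrite /= ?ob ?(negbTE ob) //=;
  by rewrite ?exprS; ring.
Qed.

Lemma lop_rel20 v :
  lop (inord 2) (lop (inord 0) v) = lop (inord 0) (lop (inord 2) v).
Proof.
rewrite -[RHS]scale1r; apply: mop_comp_eq;
  rewrite !inordK // => -[[[a b] c] d] /=;
  case: (boolP (odd b)) => ob; rewrite /= ?ob ?(negbTE ob) //=;
  by rewrite ?exprS; ring.
Qed.

Lemma lop_rel21 v :
  lop (inord 2) (lop (inord 1) v) = lop (inord 1) (lop (inord 3) v).
Proof.
rewrite -[RHS]scale1r; apply: mop_comp_eq;
  rewrite !inordK // => -[[[a b] c] d] /=;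
  rewrite ?uphalf_half; case: (boolP (odd b)) => ob; rewrite /= ?ob ?(negbTE ob) //=;
  by rewrite ?add1n ?add0n ?exprS; ring.
Qed.

Lemma lop_rel30 v :
  lop (inord 3) (lop (inord 0) v) = lop (inord 0) (lop (inord 3) v).
Proof.
rewrite -[RHS]scale1r; apply: mop_comp_eq;
  rewrite !inordK // => -[[[a b] c] d] /=;
  case: (boolP (odd b)) => ob; rewrite /= ?ob ?(negbTE ob) //=;
  by rewrite ?exprS; ring.
Qed.

Lemma lop_rel31 v :
  lop (inord 3) (lop (inord 1) v) = alpha *: lop (inord 1) (lop (inord 2) v).
Proof.
apply: mop_comp_eq; rewrite !inordK // => -[[[a b] c] d] /=;
  rewrite ?uphalf_half; case: (boolP (odd b)) => ob; rewrite /= ?ob ?(negbTE ob) //=;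
  by rewrite ?add1n ?add0n ?exprS; ring.
Qed.

(** In an algebra left and right multiplications commute; for these operators
    it is an identity between the formulas, from which [nf_right] deduces that
    they are the right multiplications. *)
Lemma lop_rop1 i v : lop i (rop1 v) = rop1 (lop i v).
Proof.
rewrite -[RHS]scale1r; apply: mop_comp_eq; elim/ord4_ind: i;
  rewrite !inordK // => -[[[a b] c] d] /=;
  case: (boolP (odd b)) => ob; rewrite /= ?ob ?(negbTE ob) //=;
  by rewrite ?exprS; ring.
Qed.

Lemma sign_cases n : (-1) ^+ n = 1 :> k \/ (-1) ^+ n = -1 :> k.
Proof. by rewrite -signr_odd; case: (odd n); [right|left]. Qed.

Lemma lop_rop2 i v : lop i (rop2 v) = rop2 (lop i v).
Proof.
rewrite -[RHS]scale1r; apply: mop_comp_eq; elim/ord4_ind: i;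
  rewrite !inordK // => -[[[a b] c] d] /=; rewrite ?uphalf_half;
  case: (boolP (odd b)) => ob; rewrite /= ?ob ?(negbTE ob) //=;
  rewrite ?add1n ?add0n ?mulSn ?mulnS ?exprD ?exprS ?[(d * c)%N]mulnC;
  by case: (sign_cases c) => sc; case: (sign_cases d) => sd; rewrite ?sc ?sd; ring.
Qed.

Lemma rop_anti v : rop1 (rop2 v) = - rop2 (rop1 v).
Proof.
rewrite -scaleN1r; apply: mop_comp_eq => -[[[a b] c] d] //=.
by rewrite exprS; ring.
Qed.


End Model.

(** * Normal forms, exactness and the resolution *)

(** The presented algebra enters only through its relations, the spanning
    words and the orbit map [nf] of the empty monomial, so the arguments are
    given for any algebra with these data. *)
Section PBW.
Variables (k : fieldType) (alpha : k).
Variables (B : algType k) (gen : 'I_4 -> B).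
Local Notation x1 := (gen (inord 0)).
Local Notation x2 := (gen (inord 1)).
Local Notation y1 := (gen (inord 2)).
Local Notation y2 := (gen (inord 3)).
Local Notation V := {malg k[exponent]}.
Local Notation lop := (lop alpha).
Local Notation rop2 := (rop2 alpha).
Local Notation lcoef := (lcoef alpha).

Hypotheses (x2x1 : x2 * x1 = - (x1 * x2)) (y2y1 : y2 * y1 = - (y1 * y2))
  (y1x1 : y1 * x1 = x1 * y1) (y1x2 : y1 * x2 = x2 * y2)
  (y2x1 : y2 * x1 = x1 * y2) (y2x2 : y2 * x2 = alpha *: (x2 * y1)).
Hypothesis B_words : forall b : B, exists s : seq (k * seq 'I_4),
  b = \sum_(t <- s) t.1 *: \prod_(i <- t.2) gen i.
Variable nf : {linear B -> V}.
Hypothesis nf1 : nf 1 = << (0, 0, 0, 0)%N >>.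
Hypothesis nf_gen : forall i b, nf (gen i * b) = lop i (nf b).

Lemma B_ind (P : B -> Prop) :
  P 0 -> P 1 -> (forall a b, P a -> P b -> P (a + b)) ->
  (forall c a, P a -> P (c *: a)) -> (forall i a, P a -> P (gen i * a)) ->
  forall b, P b.
Proof.
move=> P0 P1 PD PZ PM b; have [s ->] := B_words b.
apply: big_ind => // t _; apply: PZ; elim: t.2 => [|i w IH].
  by rewrite big_nil.
by rewrite big_cons; apply: PM.
Qed.

Definition monomial (t : exponent) : B :=
  let: (a, b, c, d) := t in x1 ^+ a * x2 ^+ b * y1 ^+ c * y2 ^+ d.

Definition expand (v : V) : B := lext monomial v.
Fact expand_linear : linear expand. Proof. exact: lext_linear. Qed.
HB.instance Definition _ := GRing.isLinear.Build k V B _ expand expand_linear.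

Lemma expandU t : expand << t >> = monomial t.
Proof. by rewrite /expand lextU scale1r. Qed.

Lemma anticomm_exp (x a : B) n :
  x * a = - (a * x) -> x * a ^+ n = (-1) ^+ n *: (a ^+ n * x).
Proof.
move=> xa; elim: n => [|n IH]; first by rewrite !expr0 scale1r mulr1 mul1r.
rewrite exprSr mulrA IH -scalerAl -(mulrA (a ^+ n) x a) xa mulrN mulrA.
by rewrite [in RHS]exprS mulN1r scaleNr scalerN.
Qed.

(** Two crossings of x2 return y1 and y2 to themselves with a factor alpha. *)
Lemma y_x2exp b :
  y1 * x2 ^+ b = alpha ^+ b./2 *: (x2 ^+ b * (if odd b then y2 else y1)) /\
  y2 * x2 ^+ b = (if odd b then alpha ^+ (b./2).+1 *: (x2 ^+ b * y1)
                  else alpha ^+ b./2 *: (x2 ^+ b * y2)).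
Proof.
elim: b => [|b [IH1 IH2]]; first by rewrite !expr0 !scale1r !mulr1 !mul1r.
rewrite /= uphalf_half !exprSr !mulrA IH1 IH2.
case: (odd b) => /=; rewrite ?add1n ?add0n -!scalerAl -!mulrA ?y1x2 ?y2x2;
  by rewrite -?scalerAr ?scalerA -?exprSr.
Qed.

Lemma gen_monomial i t :
  gen i * monomial t = lcoef i t *: monomial (lstep i t).
Proof.
case: t => -[[a b] c] d; elim/ord4_ind: i; rewrite inordK //=.
- by rewrite scale1r exprS -!mulrA.
- by rewrite !mulrA (anticomm_exp _ x2x1) exprS -!scalerAl !mulrA.
- rewrite !mulrA (commrX a y1x1) -(mulrA (x1 ^+ a)) (proj1 (y_x2exp b)).
  case: (odd b) => /=; rewrite -scalerAr -!scalerAl; last first.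
    by rewrite exprS !mulrA.
  rewrite -!mulrA (mulrA y2) (anticomm_exp _ y2y1) -!scalerAl -!scalerAr scalerA.
  by rewrite exprS !mulrA.
rewrite !mulrA (commrX a y2x1) -(mulrA (x1 ^+ a)) (proj2 (y_x2exp b)).
case: (odd b) => /=; rewrite -scalerAr -!scalerAl.
  by rewrite [y1 ^+ c.+1]exprS !mulrA.
rewrite -!mulrA (mulrA y2) (anticomm_exp _ y2y1) -!scalerAl -!scalerAr scalerA.
by rewrite exprS !mulrA.
Qed.

Lemma expand_lop i v : expand (lop i v) = gen i * expand v.
Proof.
elim/malg_ind: v => [|v w IHv IHw|y t].
- by rewrite !linear0 mulr0.
- by rewrite !linearD /= IHv IHw mulrDr.
by rewrite /lop mopU /expand !lextU -scalerAr gen_monomial scalerA.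
Qed.

(** The normal form map is [b |-> b . 1]. Expanding it back commutes with the
    generators, so it recovers [b]. Thus normal monomials span, and an element
    with zero normal form is zero. *)
Lemma nfK b : expand (nf b) = b.
Proof.
elim/B_ind: b => [||a b IHa IHb|c a IH|i a IH].
- by rewrite !linear0.
- by rewrite nf1 expandU /= !mulr1.
- by rewrite !linearD /= IHa IHb.
- by rewrite !linearZ /= IH.
by rewrite nf_gen expand_lop IH.
Qed.

Lemma nf_inj : injective nf.
Proof. exact: can_inj nfK. Qed.

Lemma nf_monomial t : nf (monomial t) = << t >>.
Proof.
have step n t' : (n < 4)%N -> lcoef n t' = 1 ->
    lop (inord n) << t' >> = << lstep n t' >>.
  move=> n4 c1; rewrite (lopE alpha n4) mopU1 c1; exact: erefl.
case: t => -[[a b] c] d; rewrite /monomial -!mulrA.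
have nf_y2 : nf (y2 ^+ d) = << (0, 0, 0, d)%N >>.
  elim: d => [|d IH]; first exact: nf1.
  by rewrite exprS nf_gen IH; apply: (step 3%N) => //=; rewrite mulr1.
have nf_y1 : nf (y1 ^+ c * y2 ^+ d) = << (0, 0, c, d)%N >>.
  elim: c => [|c IH]; first by rewrite mul1r.
  by rewrite exprS -mulrA nf_gen IH; apply: (step 2%N).
have nf_x2 : nf (x2 ^+ b * (y1 ^+ c * y2 ^+ d)) = << (0, b, c, d)%N >>.
  elim: b => [|b IH]; first by rewrite mul1r.
  by rewrite exprS -mulrA nf_gen IH; apply: (step 1%N).
elim: a => [|a IH]; first by rewrite mul1r.
by rewrite exprS -mulrA nf_gen IH; apply: (step 0%N).
Qed.

(** Each normal monomial is obtained from 1 by applying the generators in an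
    order that never requires a commutation, so all coefficients met are 1.
    Hence the normal monomials are independent. *)
Lemma expandK v : nf (expand v) = v.
Proof.
elim/malg_ind: v => [|v w IHv IHw|y t].
- by rewrite !linear0.
- by rewrite !linearD /= IHv IHw.
by rewrite malgUZ !linearZ /= expandU nf_monomial.
Qed.

Lemma nf_x1l b : nf (x1 * b) = lop (inord 0) (nf b). Proof. exact: nf_gen. Qed.
Lemma nf_x2l b : nf (x2 * b) = lop (inord 1) (nf b). Proof. exact: nf_gen. Qed.

Lemma sign_neq0 n : (-1) ^+ n != 0 :> k.
Proof. by rewrite signr_eq0. Qed.

Lemma lstep0_inj : injective (lstep 0).
Proof. by move=> [[[a b] c] d] [[[a' b'] c'] d'] [-> -> -> ->]. Qed.

Lemma lstep1_inj : injective (lstep 1).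
Proof. by move=> [[[a b] c] d] [[[a' b'] c'] d'] [-> -> -> ->]. Qed.

Lemma left_mul_x1_inj b : x1 * b = 0 -> b = 0.
Proof.
move=> /(congr1 nf); rewrite nf_x1l linear0 lopE // => e.
apply: nf_inj; rewrite linear0; apply: mop_inj e; first exact: lstep0_inj.
by move=> [[[a b'] c] d]; rewrite oner_neq0.
Qed.

(** Left multiplications by x1 and x2 are anticommuting monomial operators;
    the image of the second consists of the monomials with b > 0, a condition
    that x1 does not affect. *)
Lemma left_mul_exact u v : x1 * u + x2 * v = 0 ->
  exists w, u = x2 * w /\ v = x1 * w.
Proof.
move=> /(congr1 nf); rewrite linearD linear0 /= nf_x1l nf_x2l => uv.
have anti w : lop (inord 0) (lop (inord 1) w) = - lop (inord 1) (lop (inord 0) w).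
  by rewrite lop_rel10 opprK.
rewrite !lopE // in uv anti.
pose p : pred exponent := fun t => let: (_, b, _, _) := t in (0 < b)%N.
pose r (t : exponent) : exponent := let: (a, b, c, d) := t in (a, b.-1, c, d).
have [|||||w [uE vE]] := mop_exact (p := p) (r := r)
  lstep0_inj lstep1_inj _ _ _ _ _ anti uv.
- by move=> [[[a b'] c] d]; rewrite oner_neq0.
- by move=> [[[a b'] c] d]; apply: sign_neq0.
- by case=> [[[a b] c] d].
- by case=> [[[a b] c] d] /= /prednK->.
- by case=> [[[a b] c] d].
exists (expand w); split; apply: nf_inj.
  rewrite nf_x2l expandK (lopE alpha (isT : (1 < 4)%N)); exact: uE.
rewrite nf_x1l expandK (lopE alpha (isT : (0 < 4)%N)); exact: vE.
Qed.


Definition Bdeg (j : int) (b : B) : Prop :=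
  exists2 s : seq (k * seq 'I_4),
    {in s, forall t, (size t.2)%:Z = j}
    & b = \sum_(t <- s) t.1 *: \prod_(i <- t.2) gen i.

Lemma Bdeg_word (w : seq 'I_4) : Bdeg (size w)%:Z (\prod_(i <- w) gen i).
Proof.
exists [:: (1, w)]; last by rewrite big_seq1 scale1r.
by move=> t; rewrite inE => /eqP->.
Qed.

Lemma Bdeg0 j : Bdeg j 0.
Proof. by exists [::]; rewrite ?big_nil. Qed.

Lemma BdegD j a b : Bdeg j a -> Bdeg j b -> Bdeg j (a + b).
Proof.
move=> [s sP ->] [t tP ->]; exists (s ++ t); last by rewrite big_cat.
by move=> u; rewrite mem_cat => /orP[/sP|/tP].
Qed.

Lemma BdegZ j c a : Bdeg j a -> Bdeg j (c *: a).
Proof.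
move=> [s sP ->]; exists [seq (c * t.1, t.2) | t <- s].
  by move=> _ /mapP[t ts ->] /=; apply: sP.
by rewrite big_map scaler_sumr; apply: eq_bigr => t _; rewrite scalerA.
Qed.

Lemma BdegB j a b : Bdeg j a -> Bdeg j b -> Bdeg j (a - b).
Proof. by move=> aj bj; rewrite -scaleN1r; apply: BdegD => //; apply: BdegZ. Qed.

Lemma Bdeg_gen i : Bdeg 1 (gen i).
Proof. by have := Bdeg_word [:: i]; rewrite big_seq1. Qed.

Lemma BdegM i j a b : Bdeg i a -> Bdeg j b -> Bdeg (i + j) (a * b).
Proof.
move=> [s sP ->] [t tP ->]; rewrite mulr_suml big_seq.
apply: big_ind => [||u /sP <-]; [exact: Bdeg0|exact: BdegD|].
rewrite mulr_sumr big_seq.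
apply: big_ind => [||u' /tP <-]; [exact: Bdeg0|exact: BdegD|].
rewrite -scalerAl -scalerAr -big_cat.
by do 2!apply: BdegZ; have := Bdeg_word (u.2 ++ u'.2); rewrite size_cat PoszD.
Qed.

Lemma Bdeg_neg j a : j < 0 -> Bdeg j a -> a = 0.
Proof.
move=> j0 [s sP ->]; rewrite big_seq big1 // => t /sP tj.
by rewrite -tj in j0.
Qed.

Lemma Bdeg_zero a : Bdeg 0 a <-> exists c : k, a = c%:A.
Proof.
split=> [[s sP ->]|[c ->]]; last first.
  by apply: BdegZ; have := Bdeg_word [::]; rewrite big_nil.
exists (\sum_(t <- s) t.1); rewrite scaler_suml big_seq [RHS]big_seq.
apply: eq_bigr => t /sP /eqP; rewrite eqz_nat size_eq0 => /eqP->.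
by rewrite big_nil.
Qed.

(** Each generator acts by an operator that raises the total degree of
    monomials by one. *)
Lemma nf_deg j b : Bdeg j b -> forall t, (expdeg t)%:Z != j -> (nf b)@_t = 0.
Proof.
move=> [s sP ->] t tj; rewrite linear_sum /= raddf_sum big_seq big1 //.
move=> -[c w] /sP /= wj.
rewrite linearZ mcoeffZ /=.
suff -> : (nf (\prod_(i <- w) gen i))@_t = 0 by rewrite mulr0.
have {tj} tw : expdeg t != size w by rewrite -eqz_nat wj.
elim: w t tw {wj} => [|i w IH] t /= tw.
  rewrite big_nil nf1 mcoeffU.
  by have -> : ((0, 0, 0, 0)%N == t) = false by apply: contraNF tw => /eqP<-.
rewrite big_cons nf_gen; apply: mop_deg tw => // -[[[a b'] c'] d].
elim/ord4_ind: i; rewrite inordK //=; try (case: ifP => _ /=); lia.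
Qed.

Lemma Bdeg_span b : exists (s : seq int) (f : int -> B),
  (forall j, Bdeg j (f j)) /\ b = \sum_(j <- s) f j.
Proof.
have [L ->] := B_words b.
exists (undup [seq (size t.2)%:Z | t <- L]),
  (fun j => \sum_(t <- L | (size t.2)%:Z == j) t.1 *: \prod_(i <- t.2) gen i).
split=> [j|].
  apply: big_ind => [||t /eqP <-]; [exact: Bdeg0|exact: BdegD|].
  by apply: BdegZ; apply: Bdeg_word.
rewrite (exchange_big_dep xpredT) //= big_seq [RHS]big_seq.
apply: eq_bigr => t tL; rewrite -[RHS]big_filter.
rewrite (_ : filter _ _ = [:: (size t.2)%:Z]) ?big_seq1 //.
rewrite -(@filter_pred1_uniq _ (undup [seq (size u.2)%:Z | u <- L])) ?undup_uniq //.
  by apply: eq_filter => j; rewrite /= eq_sym ?andbT.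
by rewrite mem_undup; apply/mapP; exists t.
Qed.

(** Normal form sends a product of n generators to monomials of total degree
    n, so the coefficients of parts of distinct degrees do not interfere. *)
Lemma Bdeg_direct (s : seq int) (f : int -> B) : uniq s ->
  (forall j, Bdeg j (f j)) -> \sum_(j <- s) f j = 0 -> {in s, forall j, f j = 0}.
Proof.
move=> us fd fs j js; apply: nf_inj; rewrite linear0; apply/malgP => t.
rewrite mcoeff0; have [tj|tj] := eqVneq (expdeg t)%:Z j; last first.
  exact: nf_deg (fd j) _ tj.
have := congr1 (fun b => (nf b)@_t) fs.
rewrite linear_sum linear0 /= raddf_sum mcoeff0 (bigD1_seq j) //=.
rewrite big1 ?addr0 // => l lj.
by apply: nf_deg (fd l) _ _; rewrite tj eq_sym.
Qed.

Let Bcdeg : int -> B^c -> Prop := Bdeg.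

Lemma B_graded : is_graded Bdeg (regular_gmod Bdeg).
Proof.
split=> [j|j a b|i j a b|b|].
- exact: Bdeg0.
- exact: BdegB.
- exact: BdegM.
- exact: Bdeg_span.
exact: Bdeg_direct.
Qed.

Lemma Bc_graded : is_graded Bcdeg (regular_gmod Bcdeg).
Proof.
split=> [j|j a b|i j a b aj bj|b|].
- exact: Bdeg0.
- exact: BdegB.
- by rewrite addrC; apply: (BdegM bj aj).
- exact: Bdeg_span.
exact: Bdeg_direct.
Qed.

Let Bdeg1 : Bdeg 0 1.
Proof. by apply/Bdeg_zero; exists 1; rewrite scale1r. Qed.

Lemma right_module_resolution :
  minimal_graded_free_resolution Bcdeg (M := quot2 Bcdeg x1 x2)
    (F := koszul_mod Bcdeg)
    (koszul_d Bcdeg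
       (fun p : B * B => x1 * p.1 + x2 * p.2) (fun w : B => (x2 * w, x1 * w)))
    (quot2_pi Bcdeg x1 x2).
Proof.
apply: (@koszul_resolution B^c Bcdeg x1 x2 Bc_graded) => //.
- exact: Bdeg_neg.
- exact: Bdeg_gen.
- exact: Bdeg_gen.
- by rewrite -[LHS]/(x1 * x2 + x2 * x1) x2x1 subrr.
- exact: left_mul_x1_inj.
- exact: left_mul_exact.
Qed.

(** The complex is minimal, so each Betti number counts the generators of one
    term in one degree. *)
Lemma betti_numbers (i : nat) (j : int) :
  graded_betti Bdeg (quot2 Bcdeg x1 x2) i j
    (if (i == 0%N) && (j == 0) then 1%N
     else if (i == 1%N) && (j == 1) then 2%N
     else if (i == 2%N) && (j == 2) then 1%N
     else 0%N).
Proof.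
split.
  exists (koszul_mod Bcdeg), (koszul_d Bcdeg
    (fun p : B * B => x1 * p.1 + x2 * p.2) (fun w : B => (x2 * w, x1 * w))),
    (quot2_pi Bcdeg x1 x2).
  exact: (proj1 right_module_resolution).
move=> F d eps res; apply: (tor_dim_from_minimal Bc_graded res right_module_resolution).
have [e [edeg ebasis]] := koszul_basis Bc_graded Bdeg1 i.
have := quot_dim_free j Bc_graded Bdeg_neg Bdeg_zero
  (koszul_graded Bc_graded i) edeg ebasis.
by case: i {e edeg ebasis} => [|[|[|i]]] /=; case: eqP.
Qed.

(** An operator that commutes with all left multiplications is determined by
    its value at 1. *)
Lemma nf_right (x : B) (R : {linear V -> V}) :
  (forall i v, lop i (R v) = R (lop i v)) -> nf x = R (nf 1) ->
  forall b, nf (b * x) = R (nf b).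
Proof.
move=> RC x1E; elim/B_ind => [||a b IHa IHb|c a IH|i a IH].
- by rewrite mul0r !linear0.
- by rewrite mul1r.
- by rewrite mulrDl !linearD /= IHa IHb.
- by rewrite -scalerAl !linearZ /= IH.
by rewrite -mulrA !nf_gen IH RC.
Qed.

Lemma nf_x1r b : nf (b * x1) = rop1 (nf b).
Proof.
apply: (@nf_right x1 (@rop1 k)); first by move=> i v; apply: lop_rop1.
have := nf_monomial (1, 0, 0, 0)%N; rewrite /= !mulr1 expr1 => ->.
rewrite nf1 /rop1 mopU1; exact: erefl.
Qed.

Lemma nf_x2r b : nf (b * x2) = rop2 (nf b).
Proof.
apply: (@nf_right x2 rop2); first by move=> i v; apply: lop_rop2.
have := nf_monomial (0, 1, 0, 0)%N; rewrite /= !mulr1 mul1r expr1 => ->.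
have c1 : rcoef2 alpha (0, 0, 0, 0)%N = 1 by rewrite /= mul1r.
rewrite nf1 /rop2 mopU1 c1; exact: erefl.
Qed.

Lemma rstep2_inj : injective rstep2.
Proof. by move=> [[[a b] c] d] [[[a' b'] c'] d'] [-> -> -> ->]. Qed.

Lemma right_mul_x1_inj b : b * x1 = 0 -> b = 0.
Proof.
move=> /(congr1 nf); rewrite nf_x1r linear0 => e.
apply: nf_inj; rewrite linear0; apply: mop_inj e; first exact: lstep0_inj.
by move=> [[[a b'] c] d]; apply: sign_neq0.
Qed.

Hypothesis alpha0 : alpha != 0.

(** The same argument with right multiplications. Multiplying by x2 on the
    right exchanges the exponents of y1 and y2, so its partial inverse swaps
    them back, and its coefficients are nonzero because alpha is. *)
Lemma right_mul_exact u v : u * x1 + v * x2 = 0 ->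
  exists w, u = w * x2 /\ v = w * x1.
Proof.
move=> /(congr1 nf); rewrite linearD linear0 /= nf_x1r nf_x2r => uv.
have anti w : mop (@rcoef1 k) (lstep 0) (mop (rcoef2 alpha) rstep2 w) =
              - mop (rcoef2 alpha) rstep2 (mop (@rcoef1 k) (lstep 0) w).
  exact: rop_anti.
pose p : pred exponent := fun t => let: (_, b, _, _) := t in (0 < b)%N.
pose r (t : exponent) : exponent := let: (a, b, c, d) := t in (a, b.-1, d, c).
have [|||||w [uE vE]] := mop_exact (p := p) (r := r)
  lstep0_inj rstep2_inj _ _ _ _ _ anti uv.
- by move=> [[[a b'] c] d]; apply: sign_neq0.
- by move=> [[[a b'] c] d]; rewrite /= mulf_neq0 ?expf_neq0 ?oppr_eq0 ?oner_eq0.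
- by case=> [[[a b] c] d].
- by case=> [[[a b] c] d] /= /prednK->.
- by case=> [[[a b] c] d].
exists (expand w); split; apply: nf_inj.
  rewrite nf_x2r expandK; exact: uE.
rewrite nf_x1r expandK; exact: vE.
Qed.

Lemma left_module_resolution :
  minimal_graded_free_resolution Bdeg (M := quot2 Bdeg x1 x2)
    (F := koszul_mod Bdeg)
    (koszul_d Bdeg
       (fun p : B * B => p.1 * x1 + p.2 * x2) (fun w : B => (w * x2, w * x1)))
    (quot2_pi Bdeg x1 x2).
Proof.
apply: (koszul_resolution B_graded) => //.
- exact: Bdeg_neg.
- exact: Bdeg_gen.
- exact: Bdeg_gen.
- by rewrite x2x1 addNr.
- exact: right_mul_x1_inj.
- exact: right_mul_exact.
Qed.

(** To move x across a product, move it across the factors one by one. *)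
Lemma normal_left (x : B) : (forall i, exists g, x * gen i = g * x) ->
  forall b, exists b', x * b = b' * x.
Proof.
move=> xg; elim/B_ind => [||a b [a' IHa] [b' IHb]|c a [a' IH]|i a [a' IH]].
- by exists 0; rewrite mulr0 mul0r.
- by exists 1; rewrite mulr1 mul1r.
- by exists (a' + b'); rewrite mulrDr mulrDl IHa IHb.
- by exists (c *: a'); rewrite -scalerAr -scalerAl IH.
by have [g gE] := xg i; exists (g * a'); rewrite mulrA gE -!mulrA IH.
Qed.

Lemma normal_right (x : B) : (forall i, exists g, gen i * x = x * g) ->
  forall b, exists b', b * x = x * b'.
Proof.
move=> xg; elim/B_ind => [||a b [a' IHa] [b' IHb]|c a [a' IH]|i a [a' IH]].
- by exists 0; rewrite mulr0 mul0r.
- by exists 1; rewrite mulr1 mul1r.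
- by exists (a' + b'); rewrite mulrDr mulrDl IHa IHb.
- by exists (c *: a'); rewrite -scalerAr -scalerAl IH.
by have [g gE] := xg i; exists (g * a'); rewrite -mulrA IH !mulrA gE.
Qed.

(** Both x1 and x2 are normal elements; for x2 and y1 this uses the
    invertibility of alpha. *)
Lemma right_left_ideal_eq (b : B) :
  (exists u v, b = x1 * u + x2 * v) <-> (exists u v, b = u * x1 + v * x2).
Proof.
split=> -[u [v ->]].
  have [|u' ->] := normal_left (x := x1) _ u.
    elim/ord4_ind; [exists x1|exists (- x2)|exists y1|exists y2] => //.
    by rewrite mulNr x2x1 opprK.
  have [|v' ->] := normal_left (x := x2) _ v; last by exists u', v'.
  elim/ord4_ind; [exists (- x1)|exists x2|exists (alpha^-1 *: y2)|exists y1] => //.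
    by rewrite mulNr -x2x1.
  by rewrite -scalerAl y2x2 scalerA mulVf // scale1r.
have [|u' ->] := normal_right (x := x1) _ u.
  elim/ord4_ind; [exists x1|exists (- x2)|exists y1|exists y2] => //.
  by rewrite mulrN -x2x1.
have [|v' ->] := normal_right (x := x2) _ v; last by exists u', v'.
elim/ord4_ind; [exists (- x1)|exists x2|exists y2|exists (alpha *: y1)] => //.
  by rewrite mulrN x2x1 opprK.
by rewrite -scalerAr.
Qed.

End PBW.

Theorem proposition4p3 (k : fieldType) (alpha : k) (alpha_neq0 : alpha != 0) :
  let B := BK alpha in
  let x1 : B := BKx1 alpha in
  let x2 : B := BKx2 alpha in
  let Bdeg : int -> B -> Prop := @BKdeg k alpha in
  let Bcdeg : int -> B^c -> Prop := Bdeg in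
  let Mx : gmod B^c := quot2 Bcdeg x1 x2 in
  [/\ minimal_graded_free_resolution Bcdeg (M := Mx) (F := koszul_mod Bcdeg)
        (koszul_d Bcdeg
           (fun p : B * B => x1 * p.1 + x2 * p.2)
           (fun w : B => (x2 * w, x1 * w)))
        (quot2_pi Bcdeg x1 x2),
      (forall b : B,
         (exists u v : B, b = x1 * u + x2 * v) <->
         (exists u v : B, b = u * x1 + v * x2)),
      minimal_graded_free_resolution Bdeg (M := quot2 Bdeg x1 x2)
        (F := koszul_mod Bdeg)
        (koszul_d Bdeg
           (fun p : B * B => p.1 * x1 + p.2 * x2)
           (fun w : B => (w * x2, w * x1)))
        (quot2_pi Bdeg x1 x2)
    & forall (i : nat) (j : int),
        graded_betti Bdeg Mx i j
          (if (i == 0%N) && (j == 0) then 1%N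
           else if (i == 1%N) && (j == 1) then 2%N
           else if (i == 2%N) && (j == 2) then 1%N
           else 0%N)].
Proof.
have [[r1 r2 r3] [r4 r5 r6]] := BK_relations alpha.
have words := @BK_words k alpha.
have [nf [nf1 nf_gen]] := orbit_map (V := {malg k[exponent]})
  (T := fun i => lop alpha i) (@lop_rel10 k alpha) (@lop_rel32 k alpha)
  (@lop_rel20 k alpha) (@lop_rel21 k alpha) (@lop_rel30 k alpha)
  (@lop_rel31 k alpha) << (0, 0, 0, 0)%N >>.
move=> B x1 x2 Bdeg Bcdeg Mx; split.
- exact: (right_module_resolution (gen := @genBK k alpha) r1 r2 r3 r4 r5 r6
    words nf1 nf_gen).
- exact: (right_left_ideal_eq (gen := @genBK k alpha) r1 r3 r4 r5 r6 words alpha_neq0).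
- exact: (left_module_resolution (gen := @genBK k alpha) r1 r2 r3 r4 r5 r6
    words nf1 nf_gen alpha_neq0).
exact: (betti_numbers (gen := @genBK k alpha) r1 r2 r3 r4 r5 r6
  words nf1 nf_gen).
Qed.
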